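(* Let $\delta>0$. Suppose that $(\mathcal{A},\mathcal{B},\mathcal{C})$ satisfies Assumptions 1 and 2 (recalled in the context), and that the eigenvalues $\{\lambda_i\}_{i\in\mathbb{N}}$ of $\mathcal{A}$, sorted by decreasing real parts, satisfy $\mathrm{Re}(\lambda_i)\to-\infty$ as $i\to\infty$. Let $K_0\in\mathbb{C}^{n_u\times n_0}$, $G_0\in\mathbb{C}^{n_0\times n_y}$ be gains (independent of $n$) for which there is a Hermitian positive definite $P_0\in\mathbb{C}^{2n_0\times 2n_0}$ with $$P_0F_0+F_0^\ast P_0\prec -2\delta P_0,\qquad F_0=\begin{bmatrix}A_0+B_0K_0 & -G_0C_0\\ 0 & A_0+G_0C_0\end{bmatrix}.$$ Then there exists a sufficiently large order $n$ such that the closed-loop system formed by the decomposed system of order $n$ and the controller $\frac{\mathrm d}{\mathrm dt}\hat x=L\hat x+My+Nu$, $u=K\hat x$, with $$L=\begin{bmatrix}A_0+G_0C_0 & G_0C_1\\0&A_1\end{bmatrix},\quad M=\begin{bmatrix}-G_0\\0\end{bmatrix},\quad N=\begin{bmatrix}B_0\\ B_1\end{bmatrix},\quad K=\begin{bmatrix}K_0&0\end{bmatrix},$$ is exponentially stable with decay rate $\delta$.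
   Context: Notation. $|\cdot|$ is the Euclidean norm on $\mathbb{C}^n$ and $\|\cdot\|$ the norm of $\ell_2(\mathbb{N})$ (square summable complex sequences). $M^\ast$ is the conjugate transpose. For a square matrix $M$, $\underline\sigma(M)$ and $\bar\sigma(M)$ are the minimal and maximal real parts of its eigenvalues. $M\succ0$ means Hermitian positive definite; $M\prec N$ means $N-M\succ0$. System. On $\ell_2(\mathbb{N})$ consider $\frac{\mathrm d}{\mathrm dt}x=\mathcal{A}x+\mathcal{B}u$, $y=\mathcal{C}x$, $t\ge0$, where $\mathcal{A}:D(\mathcal{A})\subset\ell_2(\mathbb{N})\to\ell_2(\mathbb{N})$ has generalized eigenvectors $\{\upsilon_k\}_{k\in\mathbb{N}}$ forming a Riesz basis, and $\mathcal{B}:\mathbb{R}^{n_u}\to\ell_2(\mathbb{N})$, $\mathcal{C}:\ell_2(\mathbb{N})\to\mathbb{R}^{n_y}$ are bounded. Assumption 1: for any $\delta>0$ there is $n\in\mathbb{N}$ such that the generalized eigenvectors $\upsilon_k$, $k\ge n$, are associated to algebraically simple eigenvalues with real parts smaller than $-\delta$. Assumption 2: the pair $(\mathcal{A},\mathcal{B})$ is exactly controllable and the pair $(\mathcal{C},\mathcal{A})$ is exactly observable. Decomposed form of order $n$. Given $\delta>0$, let $n_0$ be the number of eigenvalues of $\mathcal{A}$ (repeated with multiplicity) with real part $\ge-\delta$, and $n_1$ the number of eigenvalues (repeated with multiplicity) with real part $<-\delta$ that are algebraically multiple. For an integer $n\ge n_0+n_1$, up to a continuous, bijective linear change of variable $\ell_2(\mathbb{N})\to\mathbb{C}^n\times\ell_2(\mathbb{N})$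 with continuous inverse (Jordan normalization and ordering of eigenvalues by decreasing real part), the system reads $$\tfrac{\mathrm d}{\mathrm dt}\begin{bmatrix}x_0\\ x_1\end{bmatrix}=\begin{bmatrix}A_0&0\\0&A_1\end{bmatrix}\begin{bmatrix}x_0\\ x_1\end{bmatrix}+\begin{bmatrix}B_0\\ B_1\end{bmatrix}u,\qquad \tfrac{\mathrm d}{\mathrm dt}z_i=a_iz_i+b_iu\ (i\in\mathbb{N}),\qquad y=\begin{bmatrix}C_0&C_1\end{bmatrix}\begin{bmatrix}x_0\\ x_1\end{bmatrix}+\sum_{i\in\mathbb{N}}c_iz_i,$$ with $A_0\in\mathbb{C}^{n_0\times n_0}$, $A_1\in\mathbb{C}^{(n-n_0)\times(n-n_0)}$, $a_i\in\mathbb{C}$ in complex Jordan normal form, $\bar\sigma(A_1)<-\delta$, $\mathrm{Re}(a_i)<\underline\sigma(A_1)$, $B_0\in\mathbb{C}^{n_0\times n_u}$, $B_1\in\mathbb{C}^{(n-n_0)\times n_u}$, $b_i\in\mathbb{C}^{1\times n_u}$, $C_0\in\mathbb{C}^{n_y\times n_0}$, $C_1\in\mathbb{C}^{n_y\times(n-n_0)}$, $c_i\in\mathbb{C}^{n_y\times1}$, $(z_i)\in\ell_2(\mathbb{N})$. The blocks $A_0,B_0,C_0$ depend on $\delta$ but not on $n$. By boundedness of $\mathcal{B},\mathcal{C}$, $\sum_i|b_i|^2<\infty$ and $\sum_i|c_i|^2<\infty$. Signals and gains may be complex-valued in these coordinates. Exponential stability with decay rate $\delta$ means: there is $\kappa\ge1$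 such that all closed-loop solutions satisfy, with $x=(x_0,x_1)$, $$|x(t)|^2+\|(z_i(t))\|^2+|\hat x(t)|^2\le\kappa e^{-\delta t}\big(|x(0)|^2+\|(z_i(0))\|^2+|\hat x(0)|^2\big),\quad t\ge0.$$ *)

(* Defs.v *)
From HB Require Import structures.
From mathcomp Require Import all_boot all_order all_algebra.
From mathcomp Require Import all_classical all_reals all_analysis.
From mathcomp Require Import complex.

Set Implicit Arguments.
Unset Strict Implicit.
Unset Printing Implicit Defensive.

Import Order.TTheory GRing.Theory Num.Theory.
Import numFieldNormedType.Exports.

Local Open Scope classical_set_scope.
Local Open Scope ring_scope.
Local Open Scope complex_scope.

(* `Re` alone is ambiguous with the version valued in the complex field. *)
Notation cRe := complex.Re.
Notation cIm := complex.Im.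
Notation cmod := ComplexField.Normc.normc.

Section Sequences.
Context {R : realType}.
Local Notation C := R[i].

Definition vsq k (v : 'cV[C]_k) : R :=
  \sum_(i < k) cmod (v i 0) ^+ 2.

Definition sqmod (x : nat -> C) : nat -> R :=
  fun i => cmod (x i) ^+ 2.

Definition ell2 : set (nat -> C) := [set x | cvgn (series (sqmod x))].

(* The squared norm; meaningful on ell2 only. *)
Definition l2sq (x : nat -> C) : R := limn (series (sqmod x)).

Definition csum (f : nat -> C) : C :=
  limn (series (fun i => cRe (f i))) +i* limn (series (fun i => cIm (f i))).

Definition vsum k (f : nat -> 'cV[C]_k) : 'cV[C]_k :=
  \col_j csum (fun i => f i j 0).

Definition cint (a b : R) (f : R -> C) : C :=
  (\int[lebesgue_measure]_(t in `[a, b]) cRe (f t)) +i*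
  (\int[lebesgue_measure]_(t in `[a, b]) cIm (f t)).

Definition l2_continuous_on (I : set R) (x : R -> nat -> C) : Prop :=
  forall t, I t -> ell2 (x t) /\
    forall e, 0 < e -> exists2 d, 0 < d &
      forall s, I s -> `|s - t| < d -> l2sq (fun i => x s i - x t i) < e.

Definition subspace (D : set (nat -> C)) : Prop :=
  D (fun=> 0) /\
  forall a x y, D x -> D y -> D (fun i => a * x i + y i).

Definition linear_on_seq (D : set (nat -> C)) (f : (nat -> C) -> nat -> C) :=
  forall a x y, D x -> D y ->
    f (fun i => a * x i + y i) = fun i => a * f x i + f y i.

Definition linear_on_vec k (D : set (nat -> C)) (f : (nat -> C) -> 'cV[C]_k) :=
  forall a x y, D x -> D y -> f (fun i => a * x i + y i) = a *: f x + f y.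

Definition riesz_basis (v : nat -> nat -> C) : Prop :=
  [/\ forall k, ell2 (v k),
      forall x, ell2 x -> forall e, 0 < e -> exists N (c : nat -> C),
        l2sq (fun i => x i - \sum_(k < N) c k * v k i) < e &
      exists m M, 0 < m /\
        forall N (c : nat -> C),
          let s := l2sq (fun i => \sum_(k < N) c k * v k i) in
          let q := \sum_(k < N) cmod (c k) ^+ 2 in
          m * q <= s /\ s <= M * q].

End Sequences.

Section System.
Context {R : realType} {nu ny : nat}.
Local Notation C := R[i].

(* [opA] is a partial operator: its values outside [dom] are irrelevant, as
   are those of [opC] outside [ell2].  Inputs and outputs are complexified. *)
Record lin_system := LinSystem {
  dom : set (nat -> C);
  opA : (nat -> C) -> nat -> C;
  opB : 'cV[C]_nu -> nat -> C;
  opC : (nat -> C) -> 'cV[C]_ny }.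

Definition wf_system (S : lin_system) : Prop :=
  [/\ [/\ dom S `<=` ell2, subspace (dom S),
          forall x, dom S x -> ell2 (opA S x) & linear_on_seq (dom S) (opA S)],
      [/\ forall u, ell2 (opB S u),
          forall a u v, opB S (a *: u + v) =
                        (fun i => a * opB S u i + opB S v i) &
          exists M, forall u, l2sq (opB S u) <= M * vsq u] &
      [/\ linear_on_vec ell2 (opC S) &
          exists M, forall x, ell2 x -> vsq (opC S x) <= M * l2sq x]].

(* v is in the kernel of (A - mu)^m, domains included. *)
Fixpoint in_ker_pow (S : lin_system) (mu : C) (m : nat) (v : nat -> C) : Prop :=
  if m is m'.+1
  then dom S v /\ in_ker_pow S mu m' (fun i => opA S v i - mu * v i)
  else forall i, v i = 0.

Definition gen_eigenvector (S : lin_system) (mu : C) (v : nat -> C) : Prop :=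
  (exists i, v i != 0) /\ exists m, in_ker_pow S mu m v.

Definition alg_simple (S : lin_system) (mu : C) : Prop :=
  exists v, gen_eigenvector S mu v /\
    forall w, gen_eigenvector S mu w -> exists c, forall i, w i = c * v i.

Definition gen_eigen_riesz (S : lin_system) (v : nat -> nat -> C)
    (mu : nat -> C) : Prop :=
  riesz_basis v /\ forall k, gen_eigenvector S (mu k) (v k).

Definition assumption1 (S : lin_system) (mu : nat -> C) : Prop :=
  forall delta : R, 0 < delta -> exists n, forall k, (n <= k)%N ->
    alg_simple S (mu k) /\ cRe (mu k) < - delta.

Definition L2_input (tau : R) (u : R -> 'cV[C]_nu) : Prop :=
  (forall j, measurable_fun `[0, tau] (fun t => cRe (u t j 0)) /\
             measurable_fun `[0, tau] (fun t => cIm (u t j 0))) /\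
  (\int[lebesgue_measure]_(t in `[0%R, tau]) (vsq (u t))%:E < +oo)%E.

(* x(t) = x(0) + A int_0^t x(s) ds + int_0^t B u(s) ds on [0, tau] *)
Definition mild_solution (S : lin_system) (tau : R) (u : R -> 'cV[C]_nu)
    (x : R -> nat -> C) : Prop :=
  l2_continuous_on `[0, tau] x /\
  forall t, 0 <= t <= tau ->
    let X := fun i => cint 0 t (fun s => x s i) in
    dom S X /\
    forall i, x t i = x 0 i + opA S X i + cint 0 t (fun s => opB S (u s) i).

Definition reachable (S : lin_system) (tau : R) (y : nat -> C) : Prop :=
  exists u x, [/\ L2_input tau u, mild_solution S tau u x,
                  forall i, x 0 i = 0 & forall i, x tau i = y i].

Definition exactly_controllable (S : lin_system) : Prop :=
  exists2 tau, 0 < tau & forall y, ell2 y -> reachable S tau y.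

Definition exactly_observable (S : lin_system) : Prop :=
  exists2 tau, 0 < tau & exists2 gam, 0 < gam &
    forall x, mild_solution S tau (fun=> 0) x ->
      gam * l2sq (x 0) <=
      \int[lebesgue_measure]_(t in `[0, tau]) vsq (opC S (x t)).

Definition approximately_controllable (S : lin_system) : Prop :=
  exists2 tau, 0 < tau & forall y, ell2 y -> forall e, 0 < e ->
    exists2 z, reachable S tau z & l2sq (fun i => y i - z i) < e.

Definition approximately_observable (S : lin_system) : Prop :=
  exists2 tau, 0 < tau &
    forall x, mild_solution S tau (fun=> 0) x ->
      (forall t, 0 <= t <= tau -> opC S (x t) = 0) -> forall i, x 0 i = 0.

(* With bounded, finite-rank B and C, exact controllability fails on ell2 (the
   controllability map is compact), and exact observability fails as soon as
   the real parts of the eigenvalues tend to -oo.  The second alternative, which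
   is implied by the first, is what keeps a theorem assuming [assumption2]
   from being vacuous. *)
Definition assumption2 (S : lin_system) : Prop :=
  (exactly_controllable S /\ exactly_observable S) \/
  (approximately_controllable S /\ approximately_observable S).

End System.
Arguments lin_system : clear implicits.

Section Decomposed.
Context {R : realType}.
Local Notation C := R[i].

(* The order of the decomposed system is n0 + m. *)
Record decomposed (nu ny n0 m : nat) := Decomposed {
  dA0 : 'M[C]_n0;
  dA1 : 'M[C]_m;
  da : nat -> C;
  dB0 : 'M[C]_(n0, nu);
  dB1 : 'M[C]_(m, nu);
  db : nat -> 'rV[C]_nu;
  dC0 : 'M[C]_(ny, n0);
  dC1 : 'M[C]_(ny, m);
  dc : nat -> 'cV[C]_ny }.

Definition jordan_mx k (M : 'M[C]_k) : Prop :=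
  forall i j : 'I_k,
    (j = i.+1 :> nat -> M i j = 0 \/ (M i j = 1 /\ M i i = M j j)) /\
    (j <> i -> j <> i.+1 :> nat -> M i j = 0).

(* (Ph0, Ph1, Phz) is the change of variable ell2 -> C^n x ell2. *)
Definition decomposed_form nu ny n0 m (S : lin_system R nu ny) (delta : R)
    (D : decomposed nu ny n0 m) : Prop :=
  [/\ jordan_mx (dA0 D), jordan_mx (dA1 D),
      forall a, eigenvalue (dA0 D) a -> - delta <= cRe a,
      forall a, eigenvalue (dA1 D) a -> cRe a < - delta &
      forall i, cRe (da D i) < - delta /\
        forall a, eigenvalue (dA1 D) a -> cRe (da D i) < cRe a] /\
  exists (Ph0 : (nat -> C) -> 'cV[C]_n0) (Ph1 : (nat -> C) -> 'cV[C]_m)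
         (Phz : (nat -> C) -> nat -> C),
    [/\ [/\ linear_on_vec ell2 Ph0, linear_on_vec ell2 Ph1,
            linear_on_seq ell2 Phz & forall x, ell2 x -> ell2 (Phz x)],
        (exists k K, 0 < k /\ forall x, ell2 x ->
           let q := vsq (Ph0 x) + vsq (Ph1 x) + l2sq (Phz x) in
           k * l2sq x <= q /\ q <= K * l2sq x),
        (forall v0 v1 w, ell2 w -> exists2 x, ell2 x &
           [/\ Ph0 x = v0, Ph1 x = v1 & Phz x = w]),
        (forall x, dom S x <-> ell2 x /\ ell2 (fun i => da D i * Phz x i)) &
        [/\ forall x, dom S x ->
              [/\ Ph0 (opA S x) = dA0 D *m Ph0 x,
                  Ph1 (opA S x) = dA1 D *m Ph1 x &
                  Phz (opA S x) = fun i => da D i * Phz x i],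
            forall u,
              [/\ Ph0 (opB S u) = dB0 D *m u, Ph1 (opB S u) = dB1 D *m u &
                  Phz (opB S u) = fun i => (db D i *m u) 0 0] &
            forall x, ell2 x ->
              opC S x = dC0 D *m Ph0 x + dC1 D *m Ph1 x +
                        vsum (fun i => Phz x i *: dc D i)]].

(* Jordan coordinates for the whole of the operator: diagonal jlam, superdiagonal jeps. *)
Record jordan_data (nu ny : nat) := JordanData {
  jlam : nat -> C;
  jeps : nat -> bool;
  jb : nat -> 'rV[C]_nu;
  jc : nat -> 'cV[C]_ny }.

Definition jordan_coef nu ny (J : jordan_data nu ny) (i j : nat) : C :=
  if j == i then jlam J i else if j == i.+1 then (jeps J i)%:R else 0.

Definition jordan_apply nu ny (J : jordan_data nu ny) (y : nat -> C) : nat -> C :=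
  fun i => jlam J i * y i + (jeps J i)%:R * y i.+1.

(* Some change of variable Phi of ell2 brings S to Jordan coordinates J, so that
   jlam J lists the eigenvalues with multiplicity, by decreasing real part. *)
Definition jordan_coordinates nu ny (S : lin_system R nu ny)
    (J : jordan_data nu ny) : Prop :=
  (forall i j, (i <= j)%N -> cRe (jlam J j) <= cRe (jlam J i)) /\
  (forall i, jeps J i -> jlam J i.+1 = jlam J i) /\
  exists Phi : (nat -> C) -> nat -> C,
    [/\ linear_on_seq ell2 Phi /\ (forall x, ell2 x -> ell2 (Phi x)),
        (exists k K, 0 < k /\ forall x, ell2 x ->
           k * l2sq x <= l2sq (Phi x) /\ l2sq (Phi x) <= K * l2sq x),
        (forall w, ell2 w -> exists2 x, ell2 x & Phi x = w),
        (forall x, dom S x <-> ell2 x /\ ell2 (jordan_apply J (Phi x))) &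
        [/\ forall x, dom S x -> Phi (opA S x) = jordan_apply J (Phi x),
            forall u, Phi (opB S u) = fun i => (jb J i *m u) 0 0 &
            forall x, ell2 x -> opC S x = vsum (fun i => Phi x i *: jc J i)]].

Definition lead_A nu ny (J : jordan_data nu ny) n0 : 'M[C]_n0 :=
  \matrix_(i, j) jordan_coef J i j.
Definition lead_B nu ny (J : jordan_data nu ny) n0 : 'M[C]_(n0, nu) :=
  \matrix_(i, j) jb J i 0 j.
Definition lead_C nu ny (J : jordan_data nu ny) n0 : 'M[C]_(ny, n0) :=
  \matrix_(i, j) jc J j i 0.

Definition decompose nu ny (J : jordan_data nu ny) (n0 n : nat) :
    decomposed nu ny n0 (n - n0) :=
  Decomposed
    (lead_A J n0)
    (\matrix_(i, j) jordan_coef J (n0 + i) (n0 + j))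
    (fun i => jlam J (n + i))
    (lead_B J n0)
    (\matrix_(i, j) jb J (n0 + i) 0 j)
    (fun i => jb J (n + i))
    (lead_C J n0)
    (\matrix_(i, j) jc J (n0 + j) i 0)
    (fun i => jc J (n + i)).

Definition ctrmx p q (M : 'M[C]_(p, q)) : 'M[C]_(q, p) := map_mx Num.conj M^T.

Definition posdefmx k (P : 'M[C]_k) : Prop :=
  ctrmx P = P /\ forall x : 'cV[C]_k, x != 0 -> 0 < (ctrmx x *m P *m x) 0 0.

Definition F0_mx nu ny n0 (A0 : 'M[C]_n0) (B0 : 'M[C]_(n0, nu))
    (C0 : 'M[C]_(ny, n0)) (K0 : 'M[C]_(nu, n0)) (G0 : 'M[C]_(n0, ny)) :
    'M[C]_(n0 + n0) :=
  block_mx (A0 + B0 *m K0) (- (G0 *m C0)) 0 (A0 + G0 *m C0).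

Definition solves (f g : R -> C) : Prop :=
  [/\ {within `[0, +oo[, continuous (fun t => cRe (f t))},
      {within `[0, +oo[, continuous (fun t => cIm (f t))} &
      forall t : R, 0 < t ->
        is_derive t 1 (fun s => cRe (f s)) (cRe (g t)) /\
        is_derive t 1 (fun s => cIm (f s)) (cIm (g t))].

Definition solves_vec k (x f : R -> 'cV[C]_k) : Prop :=
  forall i, solves (fun t => x t i 0) (fun t => f t i 0).

Section ClosedLoop.
Context {nu ny n0 m : nat} (D : decomposed nu ny n0 m).
Context (K0 : 'M[C]_(nu, n0)) (G0 : 'M[C]_(n0, ny)).

Definition ctrl_L : 'M[C]_(n0 + m) :=
  block_mx (dA0 D + G0 *m dC0 D) (G0 *m dC1 D) 0 (dA1 D).
Definition ctrl_M : 'M[C]_(n0 + m, ny) := col_mx (- G0) 0.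
Definition ctrl_N : 'M[C]_(n0 + m, nu) := col_mx (dB0 D) (dB1 D).
Definition ctrl_K : 'M[C]_(nu, n0 + m) := row_mx K0 0.

(* Componentwise equations plus continuity of z in ell2: for diagonal dynamics
   these are exactly the mild solutions. *)
Definition closed_loop_solution (x0 : R -> 'cV[C]_n0) (x1 : R -> 'cV[C]_m)
    (z : R -> nat -> C) (xh : R -> 'cV[C]_(n0 + m)) : Prop :=
  let u t := ctrl_K *m xh t in
  let y t := dC0 D *m x0 t + dC1 D *m x1 t + vsum (fun i => z t i *: dc D i) in
  [/\ solves_vec x0 (fun t => dA0 D *m x0 t + dB0 D *m u t),
      solves_vec x1 (fun t => dA1 D *m x1 t + dB1 D *m u t),
      forall i, solves (fun t => z t i)
                       (fun t => da D i * z t i + (db D i *m u t) 0 0),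
      l2_continuous_on `[0, +oo[ z &
      solves_vec xh (fun t => ctrl_L *m xh t + ctrl_M *m y t + ctrl_N *m u t)].

Definition exp_stable (delta : R) : Prop :=
  exists2 kappa : R, 1 <= kappa &
    forall x0 x1 z xh, closed_loop_solution x0 x1 z xh ->
      forall t, 0 <= t ->
        vsq (x0 t) + vsq (x1 t) + l2sq (z t) + vsq (xh t) <=
        kappa * expR (- delta * t) *
        (vsq (x0 0) + vsq (x1 0) + l2sq (z 0) + vsq (xh 0)).

End ClosedLoop.
End Decomposed.

(* Main.v *)
Require Import Defs.
From HB Require Import structures.
From mathcomp Require Import all_boot all_order all_algebra.
From mathcomp Require Import all_classical all_reals all_analysis.
From mathcomp Require Import complex.
From mathcomp Require Import ring lra.

Set Implicit Arguments.
Unset Strict Implicit.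
Unset Printing Implicit Defensive.

Import Order.TTheory GRing.Theory Num.Theory.
Import numFieldNormedType.Exports.

Local Open Scope classical_set_scope.
Local Open Scope ring_scope.
Local Open Scope complex_scope.

(** The closed loop is a feedback between a finite-dimensional part, which the
    certificate P0 makes decay at rate 2 * delta in squared norm, and infinitely
    many modes, which decay faster and faster as the order n grows.

    Write e0, e1 for the estimation errors of x0, x1, and w for the pair formed
    by the first block of the controller state and e0. Then (closed_loop_error)
    w follows F0 perturbed by the output error s = C1 e1 + sum_i c_i z_i, the
    error e1 obeys e1' = A1 e1, and x1 and z are driven by w through the input
    u. The proof is a single Lyapunov estimate for
      V = w^* P0 w + |z|^2 + t1 e1^* Q e1 + t2 x1^* Q x1,
    where Q is a diagonal Lyapunov matrix of the Jordan block A1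
    (jordan_lyapunov). The loop between w and z is the only one with gains that
    cannot be adjusted by weights; its gains are bounded independently of n,
    because the input and output coefficients in Jordan coordinates are bounded
    as a whole (jordan_input_bound, jordan_output_bound), whereas the decay rate
    - Re a_i of z tends to infinity with n. So for n large the loop is dominated
    by its diagonal part and V' <= - delta V (stable_of_fast_tail). The
    interconnection with e1 and x1 is a cascade: t1 large and t2 small absorb
    constants that may depend on n.

    Since only the components of z are differentiable, the estimate is made for
    the energy of the first N modes, with an error coming from the rest of the
    output series; on a bounded time interval this error is uniformly small, so
    that Gronwall's inequality passes to the limit in N.

    The order n must also be a legitimate cut of the spectrum: past all Jordan
    chains and multiple eigenvalues of real part below - delta, and at a strict
    drop of the real parts. Such n exist beyond any bound because the real parts
    tend to -oo (exists_strict_drop), and at such cuts the coordinates of J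
    split into the decomposed form (decomposed_form_decompose). *)

(** * Complex vectors and Hermitian forms *)

Section ComplexVectors.
Context {R : realType}.
Local Notation C := R[i].

(** The real part of conj a * b. Working with the real part of Hermitian
    products keeps every energy and every derivative real, while ctrmx remains
    the adjoint (vdot_adj). *)
Definition cdot (a b : C) : R := cRe a * cRe b + cIm a * cIm b.

Definition vdot k (u v : 'cV[C]_k) : R := \sum_i cdot (u i 0) (v i 0).

Lemma cReD (a b : C) : cRe (a + b) = cRe a + cRe b.
Proof. by case: a; case: b. Qed.

Lemma cImD (a b : C) : cIm (a + b) = cIm a + cIm b.
Proof. by case: a; case: b. Qed.

Lemma cReM (a b : C) : cRe (a * b) = cRe a * cRe b - cIm a * cIm b.
Proof. by case: a; case: b. Qed.

Lemma cImM (a b : C) : cIm (a * b) = cRe a * cIm b + cIm a * cRe b.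
Proof. by case: a; case: b. Qed.

Lemma cReN (a : C) : cRe (- a) = - cRe a. Proof. by case: a. Qed.

Lemma cImN (a : C) : cIm (- a) = - cIm a. Proof. by case: a. Qed.

Lemma cRe_sum I (r : seq I) (P : pred I) (F : I -> C) :
  cRe (\sum_(i <- r | P i) F i) = \sum_(i <- r | P i) cRe (F i).
Proof. exact: (big_morph _ cReD). Qed.

Lemma cIm_sum I (r : seq I) (P : pred I) (F : I -> C) :
  cIm (\sum_(i <- r | P i) F i) = \sum_(i <- r | P i) cIm (F i).
Proof. exact: (big_morph _ cImD). Qed.

Lemma cRe_conj (a : C) : cRe (Num.conj a) = cRe a. Proof. by case: a. Qed.

Lemma cIm_conj (a : C) : cIm (Num.conj a) = - cIm a. Proof. by case: a. Qed.

Lemma complex_eq (a b : C) : cRe a = cRe b -> cIm a = cIm b -> a = b.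
Proof. by case: a b => [ar ai] [br bi] /= -> ->. Qed.

Lemma cmod2E (a : C) : cmod a ^+ 2 = cdot a a.
Proof. by case: a => x y; rewrite /cdot /= sqr_sqrtr ?addr_ge0 ?sqr_ge0// !expr2. Qed.

Lemma cdot_ge0 (a : C) : 0 <= cdot a a.
Proof. by rewrite /cdot -!expr2 addr_ge0 ?sqr_ge0. Qed.

Lemma cdotC (a b : C) : cdot a b = cdot b a.
Proof. by rewrite /cdot mulrC [cIm a * _]mulrC. Qed.

Lemma cdotDr (a b c : C) : cdot a (b + c) = cdot a b + cdot a c.
Proof. by rewrite /cdot cReD cImD; ring. Qed.

Lemma cdotMr (a b : C) : cdot a (b * a) = cRe b * cdot a a.
Proof. by rewrite /cdot cReM cImM; ring. Qed.

Lemma cdotM_conj (a b c : C) : cdot (Num.conj a * b) c = cdot b (a * c).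
Proof. by rewrite /cdot !(cReM, cImM) cRe_conj cIm_conj; ring. Qed.

Lemma cdot_sumr I (r : seq I) (P : pred I) (F : I -> C) a :
  cdot a (\sum_(i <- r | P i) F i) = \sum_(i <- r | P i) cdot a (F i).
Proof.
apply: (big_morph (cdot a)) => [b c|]; first exact: cdotDr.
by rewrite /cdot /= !mulr0 addr0.
Qed.

Lemma cdot_suml I (r : seq I) (P : pred I) (F : I -> C) a :
  cdot (\sum_(i <- r | P i) F i) a = \sum_(i <- r | P i) cdot (F i) a.
Proof. by rewrite cdotC cdot_sumr; apply: eq_bigr => i _; rewrite cdotC. Qed.

(** The difference of the two sides is s times the squared modulus of
    a - s^-1 * b; the parameter s decides which factor pays for the product. *)
Lemma cdot_young (s : R) (a b : C) : 0 < s ->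
  2 * cdot a b <= s * cdot a a + s^-1 * cdot b b.
Proof.
move=> s0; rewrite -subr_ge0.
have -> : s * cdot a a + s^-1 * cdot b b - 2 * cdot a b =
  s * ((cRe a - s^-1 * cRe b) ^+ 2 + (cIm a - s^-1 * cIm b) ^+ 2).
  by rewrite /cdot; field; rewrite gt_eqF.
by rewrite mulr_ge0 ?(ltW s0)// addr_ge0 ?sqr_ge0.
Qed.

Lemma cdotDD (a b : C) : cdot (a + b) (a + b) <= 2 * cdot a a + 2 * cdot b b.
Proof.
have := @cdot_young 1 a b ltr01.
rewrite invr1 !mul1r cdotDr ![cdot (a + b) _]cdotC !cdotDr (cdotC b a); lra.
Qed.

Lemma vsqE k (v : 'cV[C]_k) : vsq v = vdot v v.
Proof. by apply: eq_bigr => i _; rewrite cmod2E. Qed.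

Lemma vsq_ge0 k (v : 'cV[C]_k) : 0 <= vsq v.
Proof. by apply: sumr_ge0 => i _; exact: sqr_ge0. Qed.

Lemma vsqN k (v : 'cV[C]_k) : vsq (- v) = vsq v.
Proof.
by apply: eq_bigr => i _; rewrite mxE !cmod2E /cdot cReN cImN !mulrNN.
Qed.

Lemma vsqD k (u v : 'cV[C]_k) : vsq (u + v) <= 2 * vsq u + 2 * vsq v.
Proof.
rewrite !vsqE /vdot !mulr_sumr -big_split /=; apply: ler_sum => i _.
by rewrite mxE; exact: cdotDD.
Qed.

Lemma vsqB k (u v : 'cV[C]_k) : vsq (u - v) <= 2 * vsq u + 2 * vsq v.
Proof. by rewrite -[vsq v]vsqN; exact: vsqD. Qed.

Lemma vsq_col_mx k l (u : 'cV[C]_k) (v : 'cV[C]_l) :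
  vsq (col_mx u v) = vsq u + vsq v.
Proof.
rewrite /vsq big_split_ord /=; congr (_ + _); apply: eq_bigr => i _.
  by rewrite col_mxEu.
by rewrite col_mxEd.
Qed.

Lemma vdotC k (u v : 'cV[C]_k) : vdot u v = vdot v u.
Proof. by apply: eq_bigr => i _; rewrite cdotC. Qed.

Lemma vdotDr k (u v w : 'cV[C]_k) : vdot u (v + w) = vdot u v + vdot u w.
Proof. by rewrite -big_split; apply: eq_bigr => i _; rewrite mxE cdotDr. Qed.

Lemma vdotDl k (u v w : 'cV[C]_k) : vdot (v + w) u = vdot v u + vdot w u.
Proof. by rewrite vdotC vdotDr !(vdotC u). Qed.

Lemma vdotZr k (s : R) (u v : 'cV[C]_k) : vdot u (s%:C *: v) = s * vdot u v.
Proof.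
rewrite mulr_sumr; apply: eq_bigr => i _.
by rewrite mxE /cdot cReM cImM /=; ring.
Qed.

Lemma vdotZl k (s : R) (u v : 'cV[C]_k) : vdot (s%:C *: v) u = s * vdot v u.
Proof. by rewrite vdotC vdotZr vdotC. Qed.

Lemma vdotNr k (u v : 'cV[C]_k) : vdot u (- v) = - vdot u v.
Proof.
rewrite -sumrN; apply: eq_bigr => i _.
by rewrite mxE /cdot cReN cImN; ring.
Qed.

Lemma vdot_young k (s : R) (u v : 'cV[C]_k) : 0 < s ->
  2 * vdot u v <= s * vsq u + s^-1 * vsq v.
Proof.
move=> s0; rewrite !vsqE !mulr_sumr -big_split /=; apply: ler_sum => i _.
exact: cdot_young.
Qed.

Lemma ctrmxK p q (M : 'M[C]_(p, q)) : ctrmx (ctrmx M) = M.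
Proof. by apply/matrixP => i j; rewrite !mxE conjCK. Qed.

Lemma vdot_adj p q (M : 'M[C]_(p, q)) u v :
  vdot (ctrmx M *m u) v = vdot u (M *m v).
Proof.
rewrite /vdot.
under eq_bigr do rewrite mxE cdot_suml.
rewrite exchange_big /=; apply: eq_bigr => i _.
rewrite mxE cdot_sumr; apply: eq_bigr => j _.
by rewrite !mxE cdotM_conj.
Qed.

Lemma cRe_quad k (P : 'M[C]_k) (x : 'cV[C]_k) :
  cRe ((ctrmx x *m P *m x) 0 0) = vdot x (P *m x).
Proof.
rewrite -mulmxA mxE cRe_sum; apply: eq_bigr => i _.
by rewrite /cdot !mxE cReM cRe_conj cIm_conj; ring.
Qed.

Lemma cauchy_schwarz_sum (I : Type) (r : seq I) (f g : I -> C) :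
  cmod (\sum_(i <- r) f i * g i) ^+ 2 <=
  (\sum_(i <- r) cmod (f i) ^+ 2) * (\sum_(i <- r) cmod (g i) ^+ 2).
Proof.
elim: r => [|x r IH].
  by rewrite !big_nil mul0r ComplexField.Normc.normc0 expr0n.
rewrite !big_cons; move: IH.
set S := \sum_(j <- r) _; set A := \sum_(j <- r) _; set B := \sum_(j <- r) _.
have A0 : 0 <= A by apply: sumr_ge0 => i _; exact: sqr_ge0.
have B0 : 0 <= B by apply: sumr_ge0 => i _; exact: sqr_ge0.
set a := cmod (f x); set b := cmod (g x) => IH.
have S0 : 0 <= cmod S by case: (S) => ? ?; exact: sqrtr_ge0.
have a0 : 0 <= a by rewrite /a; case: (f x) => ? ?; exact: sqrtr_ge0.
have b0 : 0 <= b by rewrite /b; case: (g x) => ? ?; exact: sqrtr_ge0.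
have T : cmod (f x * g x + S) <= a * b + cmod S.
  by rewrite /a /b -ComplexField.Normc.normcM le_normcD.
have T0 : 0 <= cmod (f x * g x + S).
  by case: (_ + S) => ? ?; exact: sqrtr_ge0.
have : cmod (f x * g x + S) ^+ 2 <= (a * b + cmod S) ^+ 2.
  by rewrite ler_sqr// nnegrE addr_ge0 ?mulr_ge0.
move/le_trans; apply.
(* the mixed term is a geometric mean of the two mixed products *)
have M : 2 * (a * b * cmod S) <= a ^+ 2 * B + A * b ^+ 2.
  rewrite -ler_sqr ?nnegrE ?addr_ge0 ?mulr_ge0 ?sqr_ge0 ?ler0n//.
  have : (a * b) ^+ 2 * cmod S ^+ 2 <= (a * b) ^+ 2 * (A * B).
    by rewrite ler_wpM2l ?sqr_ge0.
  have := sqr_ge0 (a ^+ 2 * B - A * b ^+ 2).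
  rewrite -subr_ge0 => H1 H2; rewrite -subr_ge0.
  have -> : (a ^+ 2 * B + A * b ^+ 2) ^+ 2 - (2 * (a * b * cmod S)) ^+ 2 =
    (a ^+ 2 * B - A * b ^+ 2 - 0) ^+ 2 +
    4 * ((a * b) ^+ 2 * (A * B) - (a * b) ^+ 2 * cmod S ^+ 2) by ring.
  by rewrite addr_ge0 ?sqr_ge0// mulr_ge0// subr_ge0.
nra.
Qed.

(** The squared Frobenius norm, a convenient bound for the operator norm. *)
Definition mx_sq p q (M : 'M[C]_(p, q)) : R :=
  \sum_i \sum_j cmod (M i j) ^+ 2.

Lemma mx_sq_ge0 p q (M : 'M[C]_(p, q)) : 0 <= mx_sq M.
Proof.
by apply: sumr_ge0 => i _; apply: sumr_ge0 => j _; exact: sqr_ge0.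
Qed.

Lemma vsq_mulmx p q (M : 'M[C]_(p, q)) (v : 'cV[C]_q) :
  vsq (M *m v) <= mx_sq M * vsq v.
Proof.
rewrite /mx_sq mulr_suml; apply: ler_sum => i _.
by rewrite mxE; exact: cauchy_schwarz_sum.
Qed.

Lemma vdot_posdef k (P : 'M[C]_k) (x : 'cV[C]_k) :
  posdefmx P -> 0 <= vdot x (P *m x).
Proof.
move=> [_ Ppos]; have [->|/Ppos] := eqVneq x 0.
  rewrite mulmx0 /vdot big1// => i _.
  by rewrite /cdot mxE /= !mulr0 addr0.
by rewrite -cRe_quad ltcE /= => /andP[_ /ltW].
Qed.

(** The inverse of P turns positivity into coercivity, without compactness of
    the unit sphere: with y = invmx P *m x, nonnegativity of the form at
    x - c^-1 *: y reads
    vdot x (P *m x) >= 2 * c^-1 * vsq x - c^-2 * vdot y x,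
    and c is chosen so that vdot y x <= c * vsq x. *)
Lemma posdef_coercive k (P : 'M[C]_k) : posdefmx P ->
  exists2 p : R, 0 < p & forall x, p * vsq x <= vdot x (P *m x).
Proof.
move=> Ppos; have [PH Pdef] := Ppos.
have Pu : P \in unitmx.
  rewrite -unitmx_tr -row_free_unit -kermx_eq0; apply: contraT => /rowV0Pn[v].
  move=> /sub_kermxP vP v0; have vT0 : v^T != 0 by rewrite trmx_eq0.
  have : P *m v^T = 0 by rewrite -[P]trmxK -trmx_mul vP trmx0.
  by move: (Pdef _ vT0); rewrite -mulmxA => + Pv; rewrite Pv mulmx0 mxE ltxx.
pose c := (1 + mx_sq (invmx P)) / 2; have c0 : 0 < c.
  by rewrite divr_gt0// ltr_pwDl// mx_sq_ge0.
exists c^-1 => [|x]; first by rewrite invr_gt0.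
pose y := invmx P *m x.
have Py : P *m y = x by rewrite mulmxA mulmxV// mul1mx.
have yc : vdot y x <= c * vsq x.
  have := @vdot_young _ 1 y x ltr01; rewrite mul1r invr1 mul1r.
  by have := vsq_mulmx (invmx P) x; rewrite -/y /c; lra.
have yPx : vdot y (P *m x) = vsq x by rewrite -vdot_adj PH Py vsqE.
have := vdot_posdef (x - (c^-1)%:C *: y) Ppos.
have -> : vdot (x - (c^-1)%:C *: y) (P *m (x - (c^-1)%:C *: y)) =
    vdot x (P *m x) - 2 * (c^-1 * vsq x) + c^-1 * (c^-1 * vdot y x).
  rewrite mulmxBr -scalemxAr Py vdotDl !(vdotDr, vdotNr).
  rewrite ![vdot (- _) _]vdotC !vdotNr !(vdotZr, vdotZl).
  rewrite (vdotC (P *m x)) yPx (vdotC x y) -vsqE; ring.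
have : c^-1 * (c^-1 * vdot y x) <= c^-1 * vsq x.
  by rewrite ler_wpM2l ?invr_ge0 ?(ltW c0)// mulrC ler_pdivrMr// mulrC.
lra.
Qed.

End ComplexVectors.

(** * Square summable sequences *)

Section SequenceSpace.
Context {R : realType}.
Local Notation C := R[i].

Lemma sum_nat_split (V : nmodType) (F : nat -> V) k n : (k <= n)%N ->
  \sum_(0 <= i < n) F i = \sum_(i < k) F i + \sum_(i < n - k) F (k + i)%N.
Proof. by move=> kn; rewrite -{1}(subnKC kn) big_mkord big_split_ord. Qed.

Lemma cvg_series_shift (u : nat -> R) n (l : R) :
  series (fun i => u (n + i)%N) @ \oo --> l ->
  series u @ \oo --> \sum_(0 <= i < n) u i + l.
Proof.
move=> ul; rewrite -(cvg_shiftn n).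
rewrite (_ : [sequence _]_k = (fun k => \sum_(0 <= i < n) u i +
    series (fun i => u (n + i)%N) k)).
  by apply: cvgD ul; exact: cvg_cst.
apply/funext => k; rewrite /series /= (@big_cat_nat _ _ _ n)//= ?leq_addl//.
congr (_ + _); rewrite -{1}(add0n n) big_addn addnK.
by apply: eq_bigr => i _; rewrite addnC.
Qed.

Lemma is_cvg_series_shift (u : nat -> R) n :
  cvgn (series u) -> cvgn (series (fun i => u (n + i)%N)).
Proof.
move=> cu; rewrite (_ : series _ = (fun k => series u (k + n)%N -
    \sum_(0 <= i < n) u i)).
  apply: is_cvgB; last exact: is_cvg_cst.
  by apply/cvg_ex; exists (limn (series u)); rewrite (cvg_shiftn n).
apply/funext => k; rewrite /series /=.
rewrite (@big_cat_nat _ _ _ n 0 (k + n))//= ?leq_addl// addrAC subrr add0r.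
rewrite -{2}(add0n n) big_addn addnK.
by apply: eq_bigr => i _; rewrite addnC.
Qed.

Lemma nondecreasing_sqmod (x : nat -> C) :
  nondecreasing_seq (series (sqmod x)).
Proof. by apply: nondecreasing_series => i _ _; exact: sqr_ge0. Qed.

Lemma sqmod_sum_le (x : nat -> C) N :
  ell2 x -> \sum_(0 <= i < N) cmod (x i) ^+ 2 <= l2sq x.
Proof.
by move=> hx; exact: (nondecreasing_cvgn_le (@nondecreasing_sqmod x) hx N).
Qed.

Lemma l2sq_ge0 (x : nat -> C) : ell2 x -> 0 <= l2sq x.
Proof. by move/(sqmod_sum_le 0); rewrite big_geq. Qed.

Lemma ell2_bounded (x : nat -> C) B :
  (forall N, \sum_(0 <= i < N) cmod (x i) ^+ 2 <= B) -> ell2 x.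
Proof.
move=> xB; apply: nondecreasing_is_cvgn; first exact: nondecreasing_sqmod.
by exists B => _ [N _ <-]; exact: xB.
Qed.

Lemma l2sq_le (x : nat -> C) B :
  (forall N, \sum_(0 <= i < N) cmod (x i) ^+ 2 <= B) -> l2sq x <= B.
Proof.
move=> xB; apply: limr_le; first exact: ell2_bounded xB.
by apply: nearW => N; exact: xB.
Qed.

Lemma l2sq_shift (x : nat -> C) n : ell2 (fun i => x (n + i)%N) ->
  ell2 x /\ l2sq x = \sum_(0 <= i < n) cmod (x i) ^+ 2 +
                     l2sq (fun i => x (n + i)%N).
Proof.
move=> xs; have /= xl := @cvg_series_shift (sqmod x) n _ xs.
by split; [exact: cvgP xl|apply/cvg_lim].
Qed.

Lemma ell2_shift (x : nat -> C) n : ell2 (fun i => x (n + i)%N) <-> ell2 x.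
Proof.
split=> [/l2sq_shift[]//|xs].
exact: (@is_cvg_series_shift (sqmod x)).
Qed.

Lemma l2sq_tail_cvg0 (x : nat -> C) : ell2 x ->
  (fun n => l2sq (fun i => x (n + i)%N)) @ \oo --> 0.
Proof.
move=> hx; rewrite (_ : (fun n => _) = (fun n => l2sq x - series (sqmod x) n)).
  by rewrite -(subrr (l2sq x)); apply: cvgB => //; exact: cvg_cst.
apply/funext => n; have [_ ->] := l2sq_shift ((ell2_shift x n).2 hx).
by rewrite /series /= addrAC subrr add0r.
Qed.

Lemma ell2D (x y : nat -> C) : ell2 x -> ell2 y ->
  ell2 (fun i => x i + y i) /\
  l2sq (fun i => x i + y i) <= 2 * l2sq x + 2 * l2sq y.
Proof.
move=> hx hy; have H N : \sum_(0 <= i < N) cmod (x i + y i) ^+ 2 <=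
    2 * l2sq x + 2 * l2sq y.
  apply: (@le_trans _ _ (\sum_(0 <= i < N)
      (2 * cmod (x i) ^+ 2 + 2 * cmod (y i) ^+ 2))).
    by apply: ler_sum => i _; rewrite !cmod2E; exact: cdotDD.
  by rewrite big_split /= -!mulr_sumr lerD// ler_wpM2l// sqmod_sum_le.
by split; [exact: ell2_bounded H|exact: l2sq_le].
Qed.

(** csum is a total function, so its value means something only together with
    the convergence of both series of components. *)
Definition csum_cvg (f : nat -> C) (l : C) :=
  series (fun i => cRe (f i)) @ \oo --> cRe l /\
  series (fun i => cIm (f i)) @ \oo --> cIm l.

Lemma csum_cvg_lim (f : nat -> C) l : csum_cvg f l -> csum f = l.
Proof. by move=> [fr fi]; apply: complex_eq; apply/cvg_lim. Qed.

Lemma csum_cvg_shift (f : nat -> C) n l :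
  csum_cvg (fun i => f (n + i)%N) l ->
  csum_cvg f (\sum_(0 <= i < n) f i + l).
Proof.
move=> [fr fi]; split; rewrite (cReD, cImD) (cRe_sum, cIm_sum).
  exact: (@cvg_series_shift (fun i => cRe (f i))).
exact: (@cvg_series_shift (fun i => cIm (f i))).
Qed.

Lemma csum_cvg_finite (f : nat -> C) n :
  (forall i, (n <= i)%N -> f i = 0) -> csum_cvg f (\sum_(0 <= i < n) f i).
Proof.
move=> f0; rewrite -[X in csum_cvg _ X]addr0; apply: csum_cvg_shift.
by split; apply: cvg_near_cst; apply: nearW => k; rewrite /series /= big1//
  => i _; rewrite f0 ?leq_addr.
Qed.

Lemma csum_cvg_bound (f : nat -> C) l B : csum_cvg f l ->
  (forall N, cmod (\sum_(0 <= i < N) f i) ^+ 2 <= B) -> cmod l ^+ 2 <= B.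
Proof.
move=> [fr fi] fB.
have H : (fun N => cmod (\sum_(0 <= i < N) f i) ^+ 2) @ \oo --> cmod l ^+ 2.
  rewrite (_ : (fun N => _) = (fun N => series (fun i => cRe (f i)) N *
    series (fun i => cRe (f i)) N + series (fun i => cIm (f i)) N *
    series (fun i => cIm (f i)) N)).
    by rewrite cmod2E; apply: cvgD; apply: cvgM.
  by apply/funext => N; rewrite cmod2E /cdot cRe_sum cIm_sum.
by apply: cvgr_to_le H _; apply: nearW.
Qed.

Lemma is_cvg_series_dominated (u : nat -> R) (x y : nat -> C) :
  ell2 x -> ell2 y ->
  (forall i, `|u i| <= cmod (x i) ^+ 2 + cmod (y i) ^+ 2) -> cvgn (series u).
Proof.
move=> hx hy ule; apply: normed_cvg => /=.
apply: (@series_le_cvg _ _ (sqmod x + sqmod y)) => [i|i|//|].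
- exact: normr_ge0.
- exact: le_trans (ule i).
- by apply: is_cvg_seriesD.
Qed.

Lemma quad_norm_le (a b c d : R) :
  `|a * c - b * d| <= a * a + b * b + (c * c + d * d).
Proof.
have := sqr_ge0 (a + c); have := sqr_ge0 (a - c).
have := sqr_ge0 (b + d); have := sqr_ge0 (b - d).
by rewrite ler_norml; nra.
Qed.

Lemma csum_mul (x y : nat -> C) : ell2 x -> ell2 y ->
  csum_cvg (fun i => x i * y i) (csum (fun i => x i * y i)).
Proof.
move=> hx hy; split; apply: (is_cvg_series_dominated hx hy) => i /=;
  rewrite !cmod2E /cdot ?cReM ?cImM.
  exact: quad_norm_le.
have -> : cRe (x i) * cIm (y i) + cIm (x i) * cRe (y i) =
  cRe (x i) * cIm (y i) - (- cIm (x i)) * cRe (y i) by ring.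
by rewrite -[cIm (x i) * cIm (x i)]mulrNN [X in _ <= _ + X]addrC quad_norm_le.
Qed.

Lemma csum_mul_le (x y : nat -> C) : ell2 x -> ell2 y ->
  cmod (csum (fun i => x i * y i)) ^+ 2 <= l2sq x * l2sq y.
Proof.
move=> hx hy; apply: csum_cvg_bound (csum_mul hx hy) _ => N.
apply: le_trans (cauchy_schwarz_sum _ _ _) _.
by apply: ler_pM; rewrite ?sqmod_sum_le ?sumr_ge0// => i _; exact: sqr_ge0.
Qed.

Lemma csum_mul_split (x y : nat -> C) n : ell2 x -> ell2 y ->
  csum (fun i => x i * y i) = \sum_(0 <= i < n) x i * y i +
    csum (fun i => x (n + i)%N * y (n + i)%N).
Proof.
move=> hx hy; apply: csum_cvg_lim; apply: csum_cvg_shift.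
by apply: csum_mul; apply/ell2_shift.
Qed.

End SequenceSpace.

(** * Derivatives of quadratic energies and Gronwall's inequality *)

Section Solutions.
Context {R : realType}.
Local Notation C := R[i].

Definition real_solves (f g : R -> R) :=
  {within `[0, +oo[, continuous f} /\ forall t : R, 0 < t -> is_derive t 1 f (g t).

Lemma solvesP (f g : R -> C) : solves f g <->
  real_solves (fun t => cRe (f t)) (fun t => cRe (g t)) /\
  real_solves (fun t => cIm (f t)) (fun t => cIm (g t)).
Proof.
split=> [[fr fi fg]|[[fr dr] [fi di]]].
  by split; split=> // t /fg[].
by split=> // t t0; split; [exact: dr|exact: di].
Qed.

Lemma real_solves_cst (a : R) : real_solves (fun=> a) (fun=> 0).
Proof. by split=> [|t _]; [exact: cst_continuous|exact: is_derive_cst]. Qed.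

Lemma real_solvesD f f' g g' : real_solves f f' -> real_solves g g' ->
  real_solves (fun t => f t + g t) (fun t => f' t + g' t).
Proof.
move=> [fc fd] [gc gd]; split=> [x|t t0].
  by apply: continuousD; [exact: fc|exact: gc].
by have := is_deriveD (fd t t0) (gd t t0).
Qed.

Lemma real_solvesM f f' g g' : real_solves f f' -> real_solves g g' ->
  real_solves (fun t => f t * g t) (fun t => f' t * g t + f t * g' t).
Proof.
move=> [fc fd] [gc gd]; split=> [x|t t0].
  by apply: continuousM; [exact: fc|exact: gc].
have H := is_deriveM (fd t t0) (gd t t0).
apply: (is_derive_eq H); rewrite addrC; congr (_ + _).
by rewrite [LHS]mulrC.
Qed.

Lemma real_solves_eq (f f' g g' : R -> R) : real_solves f f' -> f =1 g ->
  (forall t, 0 < t -> f' t = g' t) -> real_solves g g'.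
Proof.
move=> [fc fd] /funext <- fg; split=> // t t0; rewrite -fg//; exact: fd.
Qed.

Lemma real_solves_sum (I : Type) (r : seq I) (f f' : I -> R -> R) :
  (forall i, real_solves (f i) (f' i)) ->
  real_solves (fun t => \sum_(i <- r) f i t) (fun t => \sum_(i <- r) f' i t).
Proof.
move=> ff; elim: r => [|i r IH].
  by apply: real_solves_eq (real_solves_cst 0) _ _ => t *; rewrite big_nil.
by apply: real_solves_eq (real_solvesD (ff i) IH) _ _ => t *; rewrite big_cons.
Qed.

Lemma real_solvesZ (a : R) f f' : real_solves f f' ->
  real_solves (fun t => a * f t) (fun t => a * f' t).
Proof.
move=> ff; apply: real_solves_eq (real_solvesM (real_solves_cst a) ff) _ _ => //.
by move=> t _; rewrite mul0r add0r.
Qed.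

Lemma real_solves_cdot (f f' g g' : R -> C) : solves f f' -> solves g g' ->
  real_solves (fun t => cdot (f t) (g t))
              (fun t => cdot (f' t) (g t) + cdot (f t) (g' t)).
Proof.
move=> /solvesP[fr fi] /solvesP[gr gi].
apply: real_solves_eq (real_solvesD (real_solvesM fr gr) (real_solvesM fi gi))
  _ _ => // t _; rewrite /cdot; ring.
Qed.

Lemma solvesM (a : C) (f f' : R -> C) : solves f f' ->
  solves (fun t => a * f t) (fun t => a * f' t).
Proof.
move=> /solvesP[fr fi]; apply/solvesP; split.
  apply: real_solves_eq (real_solvesD (real_solvesZ (cRe a) fr)
    (real_solvesZ (- cIm a) fi)) _ _ => t *; rewrite cReM; ring.
apply: real_solves_eq (real_solvesD (real_solvesZ (cRe a) fi)
  (real_solvesZ (cIm a) fr)) _ _ => t *; rewrite cImM; ring.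
Qed.

Lemma solvesD (f f' g g' : R -> C) : solves f f' -> solves g g' ->
  solves (fun t => f t + g t) (fun t => f' t + g' t).
Proof.
move=> /solvesP[fr fi] /solvesP[gr gi]; apply/solvesP; split.
  by apply: real_solves_eq (real_solvesD fr gr) _ _ => t *; rewrite cReD.
by apply: real_solves_eq (real_solvesD fi gi) _ _ => t *; rewrite cImD.
Qed.

Lemma solves_eq (f f' g g' : R -> C) : solves f f' -> f =1 g ->
  (forall t, 0 < t -> f' t = g' t) -> solves g g'.
Proof.
move=> /solvesP[fr fi] fg fg'; apply/solvesP; split.
  by apply: real_solves_eq fr _ _ => t *; rewrite ?fg ?fg'.
by apply: real_solves_eq fi _ _ => t *; rewrite ?fg ?fg'.
Qed.

Lemma solves_sum (I : Type) (r : seq I) (f f' : I -> R -> C) :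
  (forall i, solves (f i) (f' i)) ->
  solves (fun t => \sum_(i <- r) f i t) (fun t => \sum_(i <- r) f' i t).
Proof.
move=> ff; apply/solvesP; split.
  by apply: real_solves_eq (@real_solves_sum _ r (fun i t => cRe (f i t))
    (fun i t => cRe (f' i t)) _) _ _ => [i|t|t _]; rewrite ?cRe_sum//;
    have /solvesP[] := ff i.
by apply: real_solves_eq (@real_solves_sum _ r (fun i t => cIm (f i t))
  (fun i t => cIm (f' i t)) _) _ _ => [i|t|t _]; rewrite ?cIm_sum//;
  have /solvesP[] := ff i.
Qed.

Lemma solves_vec_mulmx p q (M : 'M[C]_(p, q)) (x f : R -> 'cV[C]_q) :
  solves_vec x f -> solves_vec (fun t => M *m x t) (fun t => M *m f t).
Proof.
move=> xf i; apply: solves_eq (solves_sum (index_enum _)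
  (fun j => solvesM (M i j) (xf j))) _ _ => t *; by rewrite mxE.
Qed.

Lemma solves_vecB k (x f y g : R -> 'cV[C]_k) :
  solves_vec x f -> solves_vec y g ->
  solves_vec (fun t => x t - y t) (fun t => f t - g t).
Proof.
move=> xf yg i; apply: solves_eq (solvesD (xf i) (solvesM (-1) (yg i))) _ _
  => t *; by rewrite !mxE mulN1r.
Qed.

Lemma solves_vec_eq k (x f y g : R -> 'cV[C]_k) : solves_vec x f ->
  x =1 y -> (forall t, 0 < t -> f t = g t) -> solves_vec y g.
Proof.
move=> xf xy fg i; apply: solves_eq (xf i) _ _ => t *; by rewrite ?xy ?fg.
Qed.

Lemma solves_vec_usub k l (x f : R -> 'cV[C]_(k + l)) : solves_vec x f ->
  solves_vec (fun t => usubmx (x t)) (fun t => usubmx (f t)).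
Proof.
by move=> xf i; apply: solves_eq (xf (lshift l i)) _ _ => t *; rewrite mxE.
Qed.

Lemma solves_vec_dsub k l (x f : R -> 'cV[C]_(k + l)) : solves_vec x f ->
  solves_vec (fun t => dsubmx (x t)) (fun t => dsubmx (f t)).
Proof.
by move=> xf i; apply: solves_eq (xf (rshift k i)) _ _ => t *; rewrite mxE.
Qed.

Lemma solves_vec_col k l (x f : R -> 'cV[C]_k) (y g : R -> 'cV[C]_l) :
  solves_vec x f -> solves_vec y g ->
  solves_vec (fun t => col_mx (x t) (y t)) (fun t => col_mx (f t) (g t)).
Proof.
move=> xf yg i; case: (split_ordP i) => j ->.
  by apply: solves_eq (xf j) _ _ => t *; rewrite col_mxEu.
by apply: solves_eq (yg j) _ _ => t *; rewrite col_mxEd.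
Qed.

(** Both terms of the product rule agree because P is Hermitian, that is,
    self-adjoint for the real inner product vdot. *)
Lemma real_solves_quad k (P : 'M[C]_k) (x f : R -> 'cV[C]_k) :
  ctrmx P = P -> solves_vec x f ->
  real_solves (fun t => vdot (x t) (P *m x t))
              (fun t => 2 * vdot (x t) (P *m f t)).
Proof.
move=> PH xf; have Pxf := solves_vec_mulmx P xf.
apply: real_solves_eq (real_solves_sum (index_enum _)
  (fun i => real_solves_cdot (xf i) (Pxf i))) _ _ => // t _.
rewrite big_split /= -/(vdot (f t) _) -/(vdot (x t) _).
rewrite (_ : vdot (f t) _ = vdot (x t) (P *m f t)); first by rewrite mulrDl !mul1r.
by rewrite -vdot_adj PH vdotC.
Qed.

Lemma real_solves_expR (a : R) :
  real_solves (fun t => expR (a * t)) (fun t => a * expR (a * t)).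
Proof.
have H (t : R) : is_derive t 1 (fun t : R => expR (a * t)) (a * expR (a * t)).
  by apply: is_derive_eq; rewrite /= mulrC [_%:A]mulr1.
split=> // x; apply: continuous_subspaceT => t.
by apply: differentiable_continuous; apply/derivable1_diffP; have [] := H t.
Qed.

(** The function expR (d * t) * (V t - e / d) is nonincreasing on [0, T]. *)
Lemma gronwall (V V' : R -> R) (d e T : R) : 0 < d -> 0 <= e -> 0 <= T ->
  real_solves V V' -> (forall t, 0 < t < T -> V' t <= - d * V t + e) ->
  V T <= expR (- d * T) * V 0 + e / d.
Proof.
move=> d0 e0 T0 VV V'le.
have [gc gd] := real_solvesM (real_solves_expR d)
  (real_solvesD VV (real_solves_cst (- (e / d)))).
have gc' : {within `[0, T], continuous (fun t => expR (d * t) * (V t - e / d))}.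
  apply: continuous_subspaceW gc => t /=.
  by rewrite !in_itv /= andbT => /andP[].
have := @ler0_derive1_le_cc _ _ 0 T _ _ gc' T 0.
rewrite !bound_itvE mulr0 expR0 mul1r => H.
have {}H : expR (d * T) * (V T - e / d) <= V 0 - e / d.
  apply: H => // t; rewrite in_itv /= => /andP[t0 tT].
    by have [] := gd t t0.
  rewrite derive1E; have [_ ->] := gd t t0.
  rewrite (_ : _ + _ = expR (d * t) * (d * V t - e + V' t)); last first.
    by field; rewrite gt_eqF.
  rewrite mulr_ge0_le0 ?expR_ge0//.
  by have := V'le t; rewrite t0 tT => /(_ isT); lra.
have E : expR (- d * T) * expR (d * T) = 1.
  by rewrite -expRD mulNr addNr expR0.
have E0 : 0 < expR (- d * T) by exact: expR_gt0.
have : expR (- d * T) * (expR (d * T) * (V T - e / d)) <=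
  expR (- d * T) * (V 0 - e / d) by rewrite ler_wpM2l// ltW.
rewrite mulrA E mul1r mulrBr.
have : 0 <= expR (- d * T) * (e / d) by rewrite mulr_ge0 ?(ltW E0) ?divr_ge0 ?(ltW d0).
lra.
Qed.

End Solutions.

(** * Lyapunov matrices and a priori bounds *)

Section Estimates.
Context {R : realType}.
Local Notation C := R[i].

Lemma vdot_lmi k (P F : 'M[C]_k) (d : R) (x : 'cV[C]_k) : ctrmx P = P ->
  posdefmx (- (2 * d)%:C *: P - (P *m F + ctrmx F *m P)) ->
  2 * vdot x (P *m (F *m x)) <= - (2 * d) * vdot x (P *m x).
Proof.
move=> PH /vdot_posdef => /(_ x).
have E : vdot x (ctrmx F *m P *m x) = vdot x (P *m (F *m x)).
  by rewrite -mulmxA -vdot_adj ctrmxK vdotC -{1}PH vdot_adj.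
rewrite mulmxBl mulmxDl !vdotDr vdotNr vdotDr E -scalemxAl.
rewrite -rmorphN vdotZr -mulmxA; lra.
Qed.

Lemma vdot_mulmx_young k l (s : R) (M : 'M[C]_(k, l)) u v : 0 < s ->
  2 * vdot u (M *m v) <= s * vsq u + s^-1 * mx_sq M * vsq v.
Proof.
move=> s0; apply: le_trans (vdot_young u (M *m v) s0) _.
by rewrite lerD2l -mulrA ler_wpM2l ?vsq_mulmx// invr_ge0 ltW.
Qed.

Lemma sum_succ_le1 m (i : 'I_m) : \sum_(j < m) (j == i.+1 :> nat)%:R <= 1 :> R.
Proof.
have [im|im] := ltnP i.+1 m.
  rewrite (bigD1 (Ordinal im))//= eqxx big1 ?addr0// => j.
  by rewrite -val_eqE /= => /negbTE ->.
rewrite big1 ?ler01// => j _; case: eqP => // ji.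
by have := ltn_ord j; rewrite ji ltnNge im.
Qed.

Lemma sum_pred_le1 m (j : 'I_m) : \sum_(i < m) (j == i.+1 :> nat)%:R <= 1 :> R.
Proof.
have [j0|j0] := posnP j.
  by rewrite big1 ?ler01// => i _; rewrite j0.
have jm : (j.-1 < m)%N by rewrite (leq_ltn_trans _ (ltn_ord j))// leq_pred.
rewrite (bigD1 (Ordinal jm))//= prednK// eqxx big1 ?addr0// => i.
rewrite -val_eqE /= => ij; case: eqP => // jE.
by move: ij; rewrite jE eqxx.
Qed.

(** A diagonal Q with geometrically growing entries r ^ i works: by Young's
    inequality the superdiagonal entry in row i costs at most d / 4 times the
    energy of coordinate i plus 4 / d * r ^ i <= d / 4 * r ^ i.+1 times the
    squared modulus of coordinate i.+1. Each coordinate is charged at most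
    twice, which leaves 2 * d - d / 2 of the diagonal decay. Since r >= 1, Q
    dominates the identity. *)
Lemma jordan_lyapunov m (A : 'M[C]_m) (d : R) : 0 < d -> jordan_mx A ->
  (forall i, cRe (A i i) <= - d) ->
  exists Q : 'M[C]_m, [/\ ctrmx Q = Q,
    forall v, vsq v <= vdot v (Q *m v) &
    forall v, 2 * vdot v (Q *m (A *m v)) <= - (3 / 2 * d) * vdot v (Q *m v)].
Proof.
move=> d0 AJ Ad.
pose r : R := 1 + 16 / d ^+ 2.
have r1 : 1 <= r by rewrite lerDl divr_ge0// sqr_ge0.
have r0 : 0 < r := lt_le_trans ltr01 r1.
have rd k : r ^+ k * (4 / d) <= r ^+ k.+1 * (d / 4).
  rewrite exprS mulrAC mulrC ler_wpM2r ?exprn_ge0 ?(ltW r0)//.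
  by rewrite /r mulrDl mul1r -subr_ge0 (_ : _ - _ = d / 4) ?divr_ge0 ?(ltW d0)//;
    field; rewrite gt_eqF.
pose Q : 'M[C]_m := diag_mx (\row_i (r ^+ i)%:C).
have QE u v : vdot u (Q *m v) = \sum_(i < m) r ^+ i * cdot (u i 0) (v i 0).
  by apply: eq_bigr => i _; rewrite mul_diag_mx !mxE /cdot cReM cImM /=; ring.
exists Q; split => [|v|v].
- apply/matrixP => i j; rewrite !mxE; case: eqVneq => [->|ij].
    by rewrite !mulr1n; apply: complex_eq; rewrite ?cRe_conj ?cIm_conj//= oppr0.
  by rewrite !mulr0n rmorph0.
- rewrite QE vsqE; apply: ler_sum => i _.
  by rewrite -[leLHS]mul1r ler_wpM2r ?cdot_ge0// exprn_ege1.
rewrite !QE mulr_sumr.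
pose q (i : 'I_m) := r ^+ i * cdot (v i 0) (v i 0).
have q0 i : 0 <= q i by rewrite mulr_ge0 ?cdot_ge0// exprn_ge0// ltW.
have step (i : 'I_m) : 2 * (r ^+ i * cdot (v i 0) ((A *m v) i 0)) <=
    - (2 * d) * q i + \sum_(j < m) (j == i.+1 :> nat)%:R * (d / 4 * q i)
    + \sum_(j < m) (j == i.+1 :> nat)%:R * (d / 4 * q j).
  rewrite mxE (bigD1 i)//= cdotDr cdotMr cdot_sumr mulrDr mulrDr -addrA lerD//.
    by have := ler_wpM2r (q0 i) (Ad i); rewrite /q; lra.
  rewrite -big_split /= !mulr_sumr big_mkcond /=; apply: ler_sum => j _.
  have nn : 0 <= (j == i.+1 :> nat)%:R * (d / 4 * q i) +
                 (j == i.+1 :> nat)%:R * (d / 4 * q j).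
    by rewrite addr_ge0// mulr_ge0// mulr_ge0 ?divr_ge0// ltW.
  case: ifP => // ji; have [A1 A0] := AJ i j; move: nn.
  have Z : cdot (v i 0) (0 * v j 0) = 0 by rewrite mul0r /cdot /= !mulr0 addr0.
  case: eqP => [jS|jS] /=.
    case: (A1 jS) => [->|[-> _]]; first by rewrite Z !mulr0.
    move=> _; rewrite !mul1r.
    have ri : 0 < r ^+ i by exact: exprn_gt0.
    have d4 : 0 < d / 4 by rewrite divr_gt0.
    have := cdot_young (v i 0) (v j 0) d4.
    move=> /(ler_wpM2l (ltW ri)) Y; rewrite mulrCA; apply: le_trans Y _.
    have := rd i; rewrite -jS invf_div => rdi.
    rewrite mulrDr lerD//; first by rewrite /q mulrCA.
    by rewrite /q [leLHS]mulrA [leRHS]mulrA ler_wpM2r ?cdot_ge0// [leRHS]mulrC.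
  rewrite A0// ?Z ?mulr0 ?mul0r ?addr0//.
  by move=> jiE; rewrite jiE eqxx in ji.
apply: le_trans (ler_sum _ (fun i _ => step i)) _.
rewrite !big_split /= [X in _ + X]exchange_big /= -mulr_sumr.
have -> : \sum_(i < m) r ^+ i * cdot (v i 0) (v i 0) = \sum_i q i by [].
have H1 : \sum_(i < m) \sum_(j < m) (j == i.+1 :> nat)%:R * (d / 4 * q i) <=
    d / 4 * \sum_i q i.
  rewrite mulr_sumr; apply: ler_sum => i _.
  by rewrite -mulr_suml ler_piMl ?sum_succ_le1// mulr_ge0 ?divr_ge0// ltW.
have H2 : \sum_(j < m) \sum_(i < m) (j == i.+1 :> nat)%:R * (d / 4 * q j) <=
    d / 4 * \sum_i q i.
  rewrite mulr_sumr; apply: ler_sum => i _.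
  by rewrite -mulr_suml ler_piMl ?sum_pred_le1// mulr_ge0 ?divr_ge0// ltW.
lra.
Qed.

(** Continuity gives a bound near each time, compactness of [0, T] a common
    one; it is needed for the part of the output lost by truncation. *)
Lemma l2_continuous_bounded (z : R -> nat -> C) (T : R) :
  l2_continuous_on `[0, +oo[ z ->
  exists2 B, 0 <= B & forall t, 0 <= t <= T -> l2sq (z t) <= B.
Proof.
move=> zc.
have K := (compact_near_coveringP _).1 (@segment_compact R 0 T).
have [|N _ HN] := K nat \oo (fun N t => 0 <= t -> l2sq (z t) <= N%:R) _.
  move=> t /=; rewrite in_itv /= => /andP[t0 tT].
  have It : `[0, +oo[%classic t by rewrite /= in_itv /= t0.
  have [zt /(_ 1 ltr01)[d d0 dz]] := zc t It.
  have := nbhs_infty_ger (2 * 1 + 2 * l2sq (z t)).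
  move=> nb; exists (ball t d, [set N : nat | 2 * 1 + 2 * l2sq (z t) <= N%:R]).
    by split => /=; [exact: nbhsx_ballx|exact: nb].
  move=> [s N] [/= st sN] s0; apply: le_trans sN.
  have Is : `[0, +oo[%classic s by rewrite /= in_itv /= s0.
  have [zs _] := zc s Is.
  have zst : l2sq (fun i => z s i - z t i) < 1.
    by apply: dz => //; rewrite distrC.
  have nt : ell2 (fun i => - z t i).
    apply: (@ell2_bounded _ _ (l2sq (z t))) => n.
    apply: le_trans (sqmod_sum_le n zt); apply: ler_sum => i _.
    by rewrite !cmod2E /cdot cReN cImN !mulrNN.
  have [dst _] := ell2D zs nt.
  have [_] := ell2D dst zt.
  rewrite (_ : (fun i => z s i - z t i + z t i) = z s); last first.
    by apply/funext => i; rewrite subrK.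
  by move/le_trans; apply; rewrite lerD2r ler_wpM2l// ltW.
exists N%:R => // t t0T; have := HN N (leqnn N) t.
by rewrite /= in_itv /= t0T; apply => //; case/andP: t0T.
Qed.

End Estimates.

(** * The closed loop in error coordinates *)

Section ClosedLoopStability.
Context {R : realType}.
Local Notation C := R[i].

Lemma ell2_entry k (c : nat -> 'cV[C]_k) B (j : 'I_k) :
  (forall N, \sum_(0 <= i < N) vsq (c i) <= B) -> ell2 (fun i => c i j 0).
Proof.
move=> cB; apply: (@ell2_bounded _ _ B) => N; apply: le_trans (cB N).
apply: ler_sum => i _; rewrite /vsq (bigD1 j)//= lerDl.
by apply: sumr_ge0 => l _; exact: sqr_ge0.
Qed.

(** The output gain of the modes after the N-th: it measures the error of
    replacing the output series by its first N terms. *)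
Definition tail_sq k (c : nat -> 'cV[C]_k) N : R :=
  \sum_j l2sq (fun i => c (N + i)%N j 0).

Lemma tail_sq_ge0 k (c : nat -> 'cV[C]_k) B N :
  (forall n, \sum_(0 <= i < n) vsq (c i) <= B) -> 0 <= tail_sq c N.
Proof.
move=> cB; apply: sumr_ge0 => j _; apply: l2sq_ge0.
exact: ((ell2_shift (fun i => c i j 0) N).2 (ell2_entry cB)).
Qed.

Lemma tail_sq_cvg0 k (c : nat -> 'cV[C]_k) B :
  (forall N, \sum_(0 <= i < N) vsq (c i) <= B) -> tail_sq c @ \oo --> 0.
Proof.
move=> cB; rewrite /tail_sq.
rewrite -[X in _ --> X](@big1 R 0 +%R _ (index_enum 'I_k) xpredT (fun=> 0))//.
apply: (@cvg_big R _ +%R 0 xpredT add_continuous) => j _.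
exact: (l2sq_tail_cvg0 (ell2_entry (j:=j) cB)).
Qed.

(** Splitting the series at N bounds the output by the energy of the first N
    modes, the only one that can be differentiated termwise, up to an error that
    vanishes as N grows while l2sq z remains bounded. *)
Lemma vsq_vsum_le k (c : nat -> 'cV[C]_k) (z : nat -> C) B N :
  (forall n, \sum_(0 <= i < n) vsq (c i) <= B) -> ell2 z ->
  vsq (vsum (fun i => z i *: c i)) <=
  2 * (B * \sum_(0 <= i < N) cmod (z i) ^+ 2) + 2 * (tail_sq c N * l2sq z).
Proof.
move=> cB hz; pose Z := \sum_(0 <= i < N) cmod (z i) ^+ 2.
have Z0 : 0 <= Z by apply: sumr_ge0 => i _; exact: sqr_ge0.
have H j : cmod (vsum (fun i => z i *: c i) j 0) ^+ 2 <=
    2 * (Z * \sum_(0 <= i < N) cmod (c i j 0) ^+ 2) +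
    2 * (l2sq (fun i => c (N + i)%N j 0) * l2sq z).
  have hc := ell2_entry (j:=j) cB.
  have hzs := (ell2_shift z N).2 hz.
  have hcs := (ell2_shift (fun i => c i j 0) N).2 hc.
  rewrite mxE (_ : (fun i => _) = (fun i => z i * c i j 0)); last first.
    by apply/funext => i; rewrite mxE.
  rewrite (csum_mul_split N hz hc) cmod2E; apply: le_trans (cdotDD _ _) _.
  rewrite -!cmod2E lerD// ler_wpM2l//; first exact: cauchy_schwarz_sum.
  apply: le_trans (csum_mul_le hzs hcs) _; rewrite mulrC.
  rewrite ler_wpM2l ?l2sq_ge0//.
  have [_ ->] := l2sq_shift hzs; rewrite lerDr.
  by apply: sumr_ge0 => i _; exact: sqr_ge0.
apply: le_trans (ler_sum _ (fun j _ => H j)) _.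
rewrite big_split /= -!mulr_sumr -mulr_suml lerD// ler_wpM2l// mulrC.
by rewrite ler_wpM2r// exchange_big /=; exact: cB.
Qed.

(** Separation: the controller contains a copy of the block A1 driven by the
    same input, so the error e1 obeys an autonomous equation, and the dominant
    part w follows F0 perturbed only by s, the part of the output that is due to
    e1 and to the modes beyond the order. *)
Lemma closed_loop_error nu ny n0 m (D : decomposed nu ny n0 m)
    (K0 : 'M[C]_(nu, n0)) (G0 : 'M[C]_(n0, ny)) x0 x1 z xh :
  closed_loop_solution D K0 G0 x0 x1 z xh ->
  let xh0 t := usubmx (xh t) in
  let e0 t := x0 t - xh0 t in
  let e1 t := x1 t - dsubmx (xh t) in
  let w t := col_mx (xh0 t) (e0 t) in
  let s t := dC1 D *m e1 t + vsum (fun i => z t i *: dc D i) in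
  [/\ solves_vec w (fun t => F0_mx (dA0 D) (dB0 D) (dC0 D) K0 G0 *m w t
                             + col_mx (- G0) G0 *m s t),
      solves_vec e1 (fun t => dA1 D *m e1 t),
      solves_vec x1 (fun t => dA1 D *m x1 t + dB1 D *m (K0 *m xh0 t)) &
      forall i, solves (fun t => z t i)
        (fun t => da D i * z t i + (db D i *m (K0 *m xh0 t)) 0 0)].
Proof.
move=> [sx0 sx1 sz _ sxh] xh0 e0 e1 w s.
have uE t : ctrl_K K0 *m xh t = K0 *m xh0 t.
  by rewrite -{1}[xh t]vsubmxK mul_row_col mul0mx addr0.
have sx0' : solves_vec x0 (fun t => dA0 D *m x0 t + dB0 D *m (K0 *m xh0 t)).
  by apply: solves_vec_eq sx0 _ _ => // t _; rewrite uE.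
have sx1' : solves_vec x1 (fun t => dA1 D *m x1 t + dB1 D *m (K0 *m xh0 t)).
  by apply: solves_vec_eq sx1 _ _ => // t _; rewrite uE.
pose y t := dC0 D *m x0 t + dC1 D *m x1 t + vsum (fun i => z t i *: dc D i).
have sxh' : solves_vec xh (fun t => col_mx
    ((dA0 D + G0 *m dC0 D) *m xh0 t + G0 *m dC1 D *m dsubmx (xh t) - G0 *m y t
       + dB0 D *m (K0 *m xh0 t))
    (dA1 D *m dsubmx (xh t) + dB1 D *m (K0 *m xh0 t))).
  apply: solves_vec_eq sxh _ _ => // t _.
  rewrite uE -{1}[xh t]vsubmxK mul_block_col !mul_col_mx !add_col_mx.
  by rewrite !mul0mx mulNmx add0r addr0.
have su := solves_vec_usub sxh'; have sd := solves_vec_dsub sxh'.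
split => //.
- apply: solves_vec_eq (solves_vec_col su (solves_vecB sx0' su)) _ _ => // t _.
  rewrite col_mxKu /F0_mx mul_block_col mul_col_mx add_col_mx mul0mx add0r.
  rewrite /s /e1 /e0 /y !(mulmxDl, mulNmx, mulmxDr, mulmxBr, mulmxN, mulmxA).
  have addE p q (A B : 'M[C]_(p, q)) i j : (A + B) i j = A i j + B i j.
    by rewrite mxE.
  have oppE p q (A : 'M[C]_(p, q)) i j : (- A) i j = - A i j by rewrite mxE.
  by congr col_mx; apply/matrixP => i j; rewrite !(addE, oppE); ring.
- apply: solves_vec_eq (solves_vecB sx1' sd) _ _ => // t _.
  by rewrite col_mxKd opprD addrACA subrr addr0 mulmxBr.
- by move=> i; apply: solves_eq (sz i) _ _ => // t _; rewrite uE.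
Qed.

(** Diagonal modes trade their decay rate against the size of their input:
    Young's inequality with parameter g costs g out of 2 * al and multiplies the
    input energy by g^-1. *)
Lemma diag_modes_le (a : nat -> C) (z f : nat -> C) (al g M : R) N :
  0 < g -> (forall i, cRe (a i) <= - al) ->
  \sum_(0 <= i < N) cmod (f i) ^+ 2 <= M ->
  \sum_(0 <= i < N) 2 * cdot (z i) (a i * z i + f i) <=
  (- (2 * al) + g) * \sum_(0 <= i < N) cmod (z i) ^+ 2 + g^-1 * M.
Proof.
move=> g0 ale fM.
apply: (@le_trans _ _ (\sum_(0 <= i < N)
    ((- (2 * al) + g) * cmod (z i) ^+ 2 + g^-1 * cmod (f i) ^+ 2))).
  apply: ler_sum => i _; rewrite !cmod2E cdotDr cdotMr.
  have := cdot_young (z i) (f i) g0.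
  have := ler_wpM2r (cdot_ge0 (z i)) (ale i); lra.
by rewrite big_split /= -!mulr_sumr lerD2l ler_wpM2l// invr_ge0 ltW.
Qed.

End ClosedLoopStability.

(** * Exponential stability for fast truncated modes *)

Section Stability.
Context {R : realType}.
Local Notation C := R[i].

Definition lyapunov n0 m (P0 : 'M[C]_(n0 + n0)) (Q : 'M[C]_m) (t1 t2 : R)
    (w : 'cV[C]_(n0 + n0)) (e1 x1 : 'cV[C]_m) : R :=
  vdot w (P0 *m w) + t1 * vdot e1 (Q *m e1) + t2 * vdot x1 (Q *m x1).

(** The coordinates (w, e1, x1, z) are an invertible linear image of
    (x0, x1, z, xh), so decay of the total energy is exponential stability up
    to the ratio of the constants of the two-sided comparison of norms. *)
Lemma exp_stable_lyapunov nu ny n0 m (D : decomposed nu ny n0 m)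
    (K0 : 'M[C]_(nu, n0)) (G0 : 'M[C]_(n0, ny)) (d p t1 t2 : R)
    (P0 : 'M[C]_(n0 + n0)) (Q : 'M[C]_m) :
  (forall w, p * vsq w <= vdot w (P0 *m w)) -> 0 < p ->
  (forall v, vsq v <= vdot v (Q *m v)) -> 1 <= t1 -> 0 < t2 ->
  (forall x0 x1 z xh, closed_loop_solution D K0 G0 x0 x1 z xh ->
     let e1 t := x1 t - dsubmx (xh t) in
     let w t := col_mx (usubmx (xh t)) (x0 t - usubmx (xh t)) in
     forall T, 0 <= T -> lyapunov P0 Q t1 t2 (w T) (e1 T) (x1 T) + l2sq (z T) <=
       expR (- d * T) * (lyapunov P0 Q t1 t2 (w 0) (e1 0) (x1 0) + l2sq (z 0))) ->
  exp_stable D K0 G0 d.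
Proof.
move=> pP p0 Q1 t10 t20 decay.
have t1p : 0 <= t1 := le_trans ler01 t10.
pose T2 (xh0 e0 : 'cV[C]_n0) (e1 x1 : 'cV[C]_m) (zz : R) :=
  vsq xh0 + vsq e0 + vsq e1 + vsq x1 + zz.
pose lo := Num.min (Num.min p 1) t2.
pose hi := (1 + mx_sq P0) + t1 * (1 + mx_sq Q) + t2 * (1 + mx_sq Q) + 1.
have lo0 : 0 < lo by rewrite !lt_min p0 ltr01.
have [lop lo1 lot2] : [/\ lo <= p, lo <= 1 & lo <= t2].
  by split; rewrite !ge_min lexx ?orbT.
have quad_le k (M : 'M[C]_k) (v : 'cV[C]_k) : vdot v (M *m v) <= (1 + mx_sq M) * vsq v.
  have := vdot_mulmx_young M v v (@ltr01 R); rewrite invr1 !mul1r.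
  have := mulr_ge0 (mx_sq_ge0 M) (vsq_ge0 v); have := vsq_ge0 v; lra.
have lower xh0 e0 e1 x1 zz : 0 <= zz ->
    lo * T2 xh0 e0 e1 x1 zz <= lyapunov P0 Q t1 t2 (col_mx xh0 e0) e1 x1 + zz.
  move=> zz0; have H1 := pP (col_mx xh0 e0).
  have H2 := ler_wpM2l t1p (Q1 e1); have H3 := ler_wpM2l (ltW t20) (Q1 x1).
  have W0 := vsq_ge0 (col_mx xh0 e0).
  have H4 := ler_wpM2r W0 lop.
  have H5 := ler_wpM2r (vsq_ge0 e1) (le_trans lo1 t10).
  have H6 := ler_wpM2r (vsq_ge0 x1) lot2.
  have H7 := ler_wpM2r zz0 lo1.
  rewrite vsq_col_mx in H1 H4; rewrite /T2 /lyapunov; lra.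
have upper xh0 e0 e1 x1 zz : 0 <= zz ->
    lyapunov P0 Q t1 t2 (col_mx xh0 e0) e1 x1 + zz <= hi * T2 xh0 e0 e1 x1 zz.
  move=> zz0; have H1 := quad_le _ P0 (col_mx xh0 e0).
  have H2 := ler_wpM2l t1p (quad_le _ Q e1).
  have H3 := ler_wpM2l (ltW t20) (quad_le _ Q x1).
  rewrite vsq_col_mx in H1; rewrite /lyapunov.
  have a0 := vsq_ge0 xh0; have b0 := vsq_ge0 e0.
  have c0 := vsq_ge0 e1; have g0 := vsq_ge0 x1.
  pose k1 := 1 + mx_sq P0; pose k2 := t1 * (1 + mx_sq Q); pose k3 := t2 * (1 + mx_sq Q).
  have q0 : 0 <= 1 + mx_sq Q by rewrite addr_ge0 ?mx_sq_ge0.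
  have k10 : 0 <= k1 by rewrite addr_ge0 ?mx_sq_ge0.
  have k20 : 0 <= k2 by exact: mulr_ge0 t1p q0.
  have k30 : 0 <= k3 by exact: mulr_ge0 (ltW t20) q0.
  rewrite /T2 /hi -/k1 -/k2 -/k3; rewrite -/k1 in H1.
  rewrite [t1 * (_ * _)]mulrA -/k2 in H2; rewrite [t2 * (_ * _)]mulrA -/k3 in H3.
  have : 0 <= (k2 + k3 + 1) * (vsq xh0 + vsq e0) by apply: mulr_ge0; lra.
  have : 0 <= (k1 + k3 + 1) * vsq e1 by apply: mulr_ge0; lra.
  have : 0 <= (k1 + k2 + 1) * vsq x1 by apply: mulr_ge0; lra.
  have : 0 <= (k1 + k2 + k3) * zz by apply: mulr_ge0; lra.
  lra.
have hi0 : 0 <= hi.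
  have q0 : 0 <= 1 + mx_sq Q by rewrite addr_ge0 ?mx_sq_ge0.
  have := mx_sq_ge0 P0; have := mulr_ge0 t1p q0; have := mulr_ge0 (ltW t20) q0.
  by rewrite /hi; lra.
(* 9 = 3 * 3: each passage between the two systems of coordinates costs 3 *)
exists (Num.max 1 (9 * hi / lo)) => [|x0 x1 z xh sol t t0].
  by rewrite le_max lexx.
have [_ _ _ zc _] := sol.
have zell s : 0 <= s -> ell2 (z s).
  by move=> s0; have [] := zc s; rewrite /= ?in_itv /= ?s0.
pose N1 s := vsq (x0 s) + vsq (x1 s) + l2sq (z s) + vsq (xh s).
pose N2 s := T2 (usubmx (xh s)) (x0 s - usubmx (xh s)) (x1 s - dsubmx (xh s)) (x1 s) (l2sq (z s)).
have xhE s : vsq (xh s) = vsq (usubmx (xh s)) + vsq (dsubmx (xh s)).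
  by rewrite -vsq_col_mx vsubmxK.
have N12 s : 0 <= s -> N1 s <= 3 * N2 s.
  move=> s0; rewrite /N1 /N2 /T2 xhE.
  have := vsqD (x0 s - usubmx (xh s)) (usubmx (xh s)); rewrite subrK.
  have := vsqB (x1 s) (x1 s - dsubmx (xh s)); rewrite opprB addrC subrK.
  have := vsq_ge0 (usubmx (xh s)); have := vsq_ge0 (x0 s - usubmx (xh s)).
  have := vsq_ge0 (x1 s - dsubmx (xh s)); have := l2sq_ge0 (zell s s0); lra.
have N21 s : 0 <= s -> N2 s <= 3 * N1 s.
  move=> s0; rewrite /N1 /N2 /T2 xhE.
  have := vsqB (x0 s) (usubmx (xh s)); have := vsqB (x1 s) (dsubmx (xh s)).
  have := vsq_ge0 (usubmx (xh s)); have := vsq_ge0 (dsubmx (xh s)).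
  have := vsq_ge0 (x0 s); have := vsq_ge0 (x1 s); have := l2sq_ge0 (zell s s0); lra.
have := decay _ _ _ _ sol t t0 => /=.
have := lower (usubmx (xh t)) (x0 t - usubmx (xh t)) (x1 t - dsubmx (xh t)) (x1 t)
  _ (l2sq_ge0 (zell t t0)).
have := upper (usubmx (xh 0)) (x0 0 - usubmx (xh 0)) (x1 0 - dsubmx (xh 0)) (x1 0)
  _ (l2sq_ge0 (zell 0 (lexx 0))).
rewrite -/(N2 0) -/(N2 t) -/(N1 0) -/(N1 t) => U L Dc.
have E0 := expR_ge0 (- d * t).
have N10 : 0 <= N1 0.
  by rewrite /N1 !addr_ge0 ?vsq_ge0// l2sq_ge0//; exact: zell.
have F : lo * N2 t <= expR (- d * t) * (hi * (3 * N1 0)).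
  apply: le_trans L (le_trans Dc _); rewrite ler_wpM2l//.
  by apply: le_trans U _; rewrite ler_wpM2l// N21.
apply: (@le_trans _ _ (9 * hi / lo * expR (- d * t) * N1 0)); last first.
  by rewrite ler_wpM2r// ler_wpM2r// le_max lexx orbT.
apply: le_trans (N12 t t0) _.
have -> : 9 * hi / lo * expR (- d * t) * N1 0 =
  3 * ((expR (- d * t) * (hi * (3 * N1 0))) / lo) by field; rewrite gt_eqF.
by rewrite ler_wpM2l// ler_pdivlMr// mulrC.
Qed.

(** The rate al demanded of the truncated modes is fixed before the order m and
    the block A1: it depends only on the reduced loop F0, on its certificate P0
    and on bounds MB, Cc of the input and output coefficients that hold for all
    orders. The constants that do depend on A1 and C1 enter only through the
    weights t1 and t2 of the Lyapunov function: t1 is large, to dominate the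
    action of e1 on w, and t2 small, for x1 to be negligible in the balance of
    w. The decay 2 * d of w granted by P0 pays for the couplings, since only d
    is claimed. *)
Lemma stable_of_fast_tail nu ny n0 (d : R) (A0 : 'M[C]_n0)
    (B0 : 'M[C]_(n0, nu)) (C0 : 'M[C]_(ny, n0)) (K0 : 'M[C]_(nu, n0))
    (G0 : 'M[C]_(n0, ny)) (P0 : 'M[C]_(n0 + n0)) (MB Cc : R) :
  0 < d -> posdefmx P0 ->
  (let F0 := F0_mx A0 B0 C0 K0 G0 in
   posdefmx (- (2 * d)%:C *: P0 - (P0 *m F0 + ctrmx F0 *m P0))) ->
  0 <= MB ->
  exists al : R, forall m (D : decomposed nu ny n0 m),
    [/\ dA0 D = A0, dB0 D = B0 & dC0 D = C0] ->
    jordan_mx (dA1 D) -> (forall i, cRe (dA1 D i i) <= - d) ->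
    (forall i, cRe (da D i) <= - al) ->
    (forall N u, \sum_(0 <= i < N) cmod ((db D i *m u) 0 0) ^+ 2 <= MB * vsq u) ->
    (forall N, \sum_(0 <= i < N) vsq (dc D i) <= Cc) ->
    exp_stable D K0 G0 d.
Proof.
move=> d0 P0pos /= hLMI MB0.
have [p p0 pP] := posdef_coercive P0pos.
have [PH _] := P0pos.
(* cs bounds the action of the output error s on w, at the price d / 4 of the
   decay of w *)
pose cs : R := (d * p / 4)^-1 * mx_sq (P0 *m col_mx (- G0) G0).
have dp : 0 < d * p / 4 by rewrite divr_gt0// mulr_gt0.
have cs0 : 0 <= cs by rewrite mulr_ge0 ?invr_ge0 ?(ltW dp) ?mx_sq_ge0.
(* ga is the Young parameter for which the input of the fast modes also costs
   d / 4 of the decay of w *)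
pose ga : R := (4 * (MB * mx_sq K0) + 1) / (d * p).
have MK0 : 0 <= MB * mx_sq K0 by rewrite mulr_ge0 ?mx_sq_ge0.
have ga0 : 0 < ga by rewrite divr_gt0 ?mulr_gt0//; lra.
have gaM : ga^-1 * (MB * mx_sq K0) <= d / 4 * p.
  rewrite /ga invf_div mulrAC ler_pdivrMr; last lra.
  have : 0 <= d * p by rewrite mulr_ge0 ?(ltW d0) ?(ltW p0).
  nra.
exists ((ga + 4 * cs * Cc + d) / 2) => m D [EA EB EC] AJ Ad hal hB hC.
have Cc0 : 0 <= Cc by have := hC 0; rewrite big_geq.
have [Q [QH Q1 QA]] := jordan_lyapunov d0 AJ Ad.
pose t1 : R := 4 * cs * mx_sq (dC1 D) / d + 1.
have t10 : 1 <= t1.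
  by rewrite lerDr divr_ge0 ?(ltW d0)// mulr_ge0 ?mx_sq_ge0// mulr_ge0.
have t1E : d * t1 = 4 * cs * mx_sq (dC1 D) + d by rewrite /t1; field; rewrite gt_eqF.
pose MX := mx_sq (Q *m dB1 D *m K0).
have MX0 : 0 <= MX by exact: mx_sq_ge0.
pose t2 : R := d * d * p / (4 * (MX + 1)).
have t20 : 0 < t2 by rewrite divr_gt0 ?mulr_gt0 //; lra.
have t2E : t2 * ((d / 2)^-1 * MX) <= d / 2 * p.
  have -> : t2 * ((d / 2)^-1 * MX) = d / 2 * p * (MX / (MX + 1)).
    by rewrite /t2; field; rewrite !gt_eqF//; lra.
  rewrite ler_piMr ?mulr_ge0 ?divr_ge0 ?(ltW d0) ?(ltW p0)//.
  by rewrite ler_pdivrMr; lra.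
pose V := @lyapunov n0 m P0 Q t1 t2.
have decay x0 x1 z xh : closed_loop_solution D K0 G0 x0 x1 z xh ->
    let xh0 t := usubmx (xh t) in
    let e1 t := x1 t - dsubmx (xh t) in
    let w t := col_mx (xh0 t) (x0 t - xh0 t) in
    forall T, 0 <= T -> V (w T) (e1 T) (x1 T) + l2sq (z T) <=
      expR (- d * T) * (V (w 0) (e1 0) (x1 0) + l2sq (z 0)).
  move=> sol xh0 e1 w T T0.
  have [sw se1 sx1 sz] := closed_loop_error sol.
  have [_ _ _ zc _] := sol.
  have [B B0' zB] := l2_continuous_bounded T zc.
  have zell t : 0 <= t -> ell2 (z t).
    by move=> t0; have [] := zc t; rewrite /= ?in_itv /= ?t0.
  (* Only finite sums of modes are differentiated; the last term is the price of
     truncating the output series, and vanishes as N grows. *)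
  have VN N : V (w T) (e1 T) (x1 T) + \sum_(0 <= i < N) cmod (z T i) ^+ 2 <=
      expR (- d * T) * (V (w 0) (e1 0) (x1 0) + l2sq (z 0)) +
      4 * cs * tail_sq (dc D) N * B / d.
    have tl0 := tail_sq_ge0 N hC.
    have r0 : 0 <= 4 * cs * tail_sq (dc D) N * B by do 3 apply: mulr_ge0 => //.
    pose s t := dC1 D *m e1 t + vsum (fun i => z t i *: dc D i).
    pose f t i := (db D i *m (K0 *m xh0 t)) 0 0.
    have SV : real_solves
      (fun t => V (w t) (e1 t) (x1 t) + \sum_(0 <= i < N) cmod (z t i) ^+ 2)
      (fun t => 2 * vdot (w t) (P0 *m (F0_mx A0 B0 C0 K0 G0 *m w t)) +
        2 * vdot (w t) (P0 *m col_mx (- G0) G0 *m s t) +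
        t1 * (2 * vdot (e1 t) (Q *m (dA1 D *m e1 t))) +
        t2 * (2 * vdot (x1 t) (Q *m (dA1 D *m x1 t)) +
              2 * vdot (x1 t) (Q *m dB1 D *m K0 *m xh0 t)) +
        \sum_(0 <= i < N) 2 * cdot (z t i) (da D i * z t i + f t i)).
      apply: real_solves_eq (real_solvesD (real_solvesD (real_solvesD
        (real_solves_quad PH sw) (real_solvesZ t1 (real_solves_quad QH se1)))
        (real_solvesZ t2 (real_solves_quad QH sx1)))
        (real_solves_sum (index_iota 0 N) (fun i => real_solves_cdot (sz i) (sz i))))
        _ _ => [t|t _].
        by congr (_ + _); apply: eq_bigr => i _; rewrite cmod2E.
      rewrite EA EB EC [P0 *m (_ + _)]mulmxDr vdotDr [Q *m (_ + _)]mulmxDr vdotDr.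
      rewrite !mulrDr !mulmxA; congr (_ + _); apply: eq_bigr => i _.
      by rewrite [cdot _ (z t i)]cdotC mulrDl !mul1r /f mulmxA.
    apply: le_trans (gronwall d0 r0 T0 SV _) _; last first.
      rewrite lerD2r ler_wpM2l ?expR_ge0// lerD2l sqmod_sum_le//.
      exact: zell.
    move=> t /andP[/ltW t0 /ltW tT].
    have zt := zell t t0.
    set zN := \sum_(0 <= i < N) cmod (z t i) ^+ 2.
    have L4 := diag_modes_le (N := N) (z t) ga0 hal (hB N (K0 *m xh0 t)).
    rewrite -/zN -/(f t) in L4.
    have wx : vsq (xh0 t) <= vsq (w t).
      by rewrite vsq_col_mx lerDl vsq_ge0.
    have L1 : 2 * vdot (w t) (P0 *m (F0_mx A0 B0 C0 K0 G0 *m w t))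
        <= - (2 * d) * vdot (w t) (P0 *m w t) by exact: vdot_lmi.
    have L2 := vdot_mulmx_young (P0 *m col_mx (- G0) G0) (w t) (s t) dp.
    rewrite -/cs in L2.
    have L3 := vsqD (dC1 D *m e1 t) (vsum (fun i => z t i *: dc D i)).
    rewrite -/(s t) in L3.
    have L3a := vsq_mulmx (dC1 D) (e1 t).
    have L3b := vsq_vsum_le N hC zt; rewrite -/zN in L3b.
    have L5 := QA (e1 t).
    have L6 := QA (x1 t).
    have d2 : 0 < d / 2 by rewrite divr_gt0.
    have L7 := vdot_mulmx_young (Q *m dB1 D *m K0) (x1 t) (xh0 t) d2.
    rewrite -/MX in L7.
    have L8 := pP (w t).
    have L9 := Q1 (x1 t); have L10 := Q1 (e1 t).
    have L11 := vsq_mulmx K0 (xh0 t).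
    rewrite -/(f t) in L4.
    set S := vdot (w t) (P0 *m w t) in L1 L8 *.
    set E := vdot (e1 t) (Q *m e1 t) in L5 L10 *.
    set X := vdot (x1 t) (Q *m x1 t) in L6 L9 *.
    have W0 := vsq_ge0 (w t).
    have zN0 : 0 <= zN by apply: sumr_ge0 => i _; exact: sqr_ge0.
    have E0 : 0 <= E := le_trans (vsq_ge0 _) L10.
    have Ba : cs * vsq (s t) <=
        2 * cs * mx_sq (dC1 D) * E + 4 * cs * Cc * zN + 4 * cs * tail_sq (dc D) N * B.
      have : vsq (s t) <= 2 * (mx_sq (dC1 D) * E) +
                          2 * (2 * (Cc * zN) + 2 * (tail_sq (dc D) N * B)).
        have : mx_sq (dC1 D) * vsq (e1 t) <= mx_sq (dC1 D) * E.
          by rewrite ler_wpM2l ?mx_sq_ge0.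
        have : tail_sq (dc D) N * l2sq (z t) <= tail_sq (dc D) N * B.
          by rewrite ler_wpM2l// zB// t0.
        lra.
      by move/(ler_wpM2l cs0)/le_trans; apply; lra.
    have Bb : ga^-1 * (MB * vsq (K0 *m xh0 t)) <= d / 4 * S.
      have : MB * vsq (K0 *m xh0 t) <= MB * (mx_sq K0 * vsq (w t)).
        rewrite ler_wpM2l//; apply: le_trans L11 _.
        by rewrite ler_wpM2l ?mx_sq_ge0.
      have ga0' : 0 <= ga^-1 by rewrite invr_ge0 ltW.
      move/(ler_wpM2l ga0')/le_trans; apply.
      have := ler_wpM2r W0 gaM; have d4 : 0 <= d / 4 by lra.
      by have := ler_wpM2l d4 L8; lra.
    have Bc : t1 * (2 * vdot (e1 t) (Q *m (dA1 D *m e1 t))) <=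
        - d * (t1 * E) - 2 * cs * mx_sq (dC1 D) * E.
      have t1p : 0 <= t1 by lra.
      have := ler_wpM2l t1p L5.
      have : 2 * cs * mx_sq (dC1 D) * E <= d / 2 * (t1 * E).
        rewrite mulrA ler_wpM2r//; lra.
      lra.
    have Bd : t2 * (2 * vdot (x1 t) (Q *m (dA1 D *m x1 t)) +
              2 * vdot (x1 t) (Q *m dB1 D *m K0 *m xh0 t)) <=
        - d * (t2 * X) + d / 2 * S.
      have : 2 * vdot (x1 t) (Q *m (dA1 D *m x1 t)) +
             2 * vdot (x1 t) (Q *m dB1 D *m K0 *m xh0 t) <=
             - d * X + (d / 2)^-1 * MX * vsq (w t).
        have := ler_wpM2l (ltW d2) L9.
        have m0 : 0 <= (d / 2)^-1 * MX by rewrite mulr_ge0// invr_ge0 ltW.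
        have := ler_wpM2l m0 wx; lra.
      move/(ler_wpM2l (ltW t20))/le_trans; apply.
      have := ler_wpM2r W0 t2E.
      by have := ler_wpM2l (ltW d2) L8; lra.
    have := ler_wpM2l (ltW d2) L8.
    by rewrite /V /lyapunov -/S -/E -/X; lra.
  have lhs : (fun N => V (w T) (e1 T) (x1 T) + series (sqmod (z T)) N) @ \oo -->
      V (w T) (e1 T) (x1 T) + l2sq (z T).
    by apply: cvgD; [exact: cvg_cst|exact: (zell T T0)].
  have rhs : (fun N => expR (- d * T) * (V (w 0) (e1 0) (x1 0) + l2sq (z 0)) +
      tail_sq (dc D) N * (4 * cs * B / d)) @ \oo -->
      expR (- d * T) * (V (w 0) (e1 0) (x1 0) + l2sq (z 0)) + 0 * (4 * cs * B / d).
    apply: cvgD; first exact: cvg_cst.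
    by apply: cvgM; [exact: tail_sq_cvg0 hC|exact: cvg_cst].
  rewrite mul0r addr0 in rhs.
  apply: ler_cvg_to lhs rhs _; apply: nearW => N.
  by apply: le_trans (VN N) _; rewrite lerD2l; lra.
exact: (exp_stable_lyapunov pP p0 Q1 t10 t20 decay).
Qed.

End Stability.

(** * Jordan coordinates, blocks and cardinalities *)

Section Decomposition.
Context {R : realType}.
Local Notation C := R[i].

(** Look at the first nonzero entry of a left eigenvector: the matrix being upper
    triangular, only the diagonal entry contributes there. *)
Lemma jordan_eigenvalue k (M : 'M[C]_k) a :
  jordan_mx M -> eigenvalue M a -> exists i, a = M i i.
Proof.
move=> MJ /eigenvalueP[v vM /rV0Pn[i0 vi0]].
case: (@arg_minnP _ i0 (fun i => v 0 i != 0) (fun i => i : nat) vi0) => i vi imin.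
exists i; apply: (mulIf vi); move/rowP/(_ i): vM; rewrite !mxE => <-.
rewrite (bigD1 i)//= big1 ?addr0 1?mulrC// => j ji.
have [ij|ij] := ltnP i j.
  have [_ ->] := MJ j i; rewrite ?mulr0// => e.
    by rewrite e eqxx in ji.
  by move: ij; rewrite e ltnNge leqnSn.
have [->|/imin] := eqVneq (v 0 j) 0; first by rewrite mul0r.
by rewrite leqNgt ltn_neqAle ij val_eqE ji.
Qed.

Lemma jordan_coef_mx nu ny (J : jordan_data nu ny) a k :
  (forall i, jeps J i -> jlam J i.+1 = jlam J i) ->
  jordan_mx (\matrix_(i < k, j < k) (jordan_coef J (a + i) (a + j) : C)).
Proof.
move=> Jeps i j; rewrite !mxE /jordan_coef !eqn_add2l -addnS eqn_add2l !eqxx.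
split=> [ji|ji jSi].
  rewrite ji eqxx gtn_eqF//.
  case E: (jeps J (a + i)); last by left.
  by right; rewrite addnS Jeps.
by case: eqP => [/val_inj//|_]; case: eqP.
Qed.

(** The infinite Jordan operator restricts to the block of indices from a to
    a + k as long as no Jordan chain crosses the end of the block. *)
Lemma jordan_coef_apply nu ny (J : jordan_data nu ny) a k (y : nat -> C)
    (i : 'I_k) : (forall l, l.+1 = (a + k)%N -> jeps J l = false) ->
  \sum_(j < k) jordan_coef J (a + i) (a + j) * y (a + j)%N =
  jordan_apply J y (a + i).
Proof.
move=> last_eps; rewrite /jordan_apply (bigD1 i)//= {1}/jordan_coef eqxx.
congr (_ + _); have [ik|ik] := ltnP i.+1 k.
  have ne : Ordinal ik != i by rewrite -val_eqE /= gtn_eqF.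
  rewrite (bigD1 (Ordinal ik))//= big1 ?addr0 => [|j /andP[ji jS]].
    by rewrite /jordan_coef !addnS eqxx gtn_eqF.
  rewrite -val_eqE in ji; rewrite -val_eqE /= in jS.
  by rewrite /jordan_coef -addnS !eqn_add2l (negbTE ji) (negbTE jS) mul0r.
rewrite last_eps ?mul0r; last first.
  by rewrite -addnS; congr addn; apply/eqP; rewrite eqn_leq ltn_ord.
rewrite big1// => j ji; rewrite /jordan_coef -addnS !eqn_add2l.
rewrite -val_eqE in ji; rewrite (negbTE ji) (_ : (j == i.+1 :> nat) = false).
  by rewrite mul0r.
by apply/negbTE; rewrite neq_ltn (leq_trans (ltn_ord j) ik).
Qed.

Definition cat_vec k (v : 'cV[C]_k) (w : nat -> C) : nat -> C :=
  fun i => if insub i is Some j then v j 0 else w (i - k)%N.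

Lemma cat_vec_lt k (v : 'cV[C]_k) w (i : 'I_k) : cat_vec v w i = v i 0.
Proof. by rewrite /cat_vec valK. Qed.

Lemma cat_vec_ge k (v : 'cV[C]_k) w i : cat_vec v w (k + i)%N = w i.
Proof. by rewrite /cat_vec insubN ?addKn// -leqNgt leq_addr. Qed.

Lemma downset_card (D : set nat) n : (forall i j, (i <= j)%N -> D j -> D i) ->
  (D #= `I_n)%card -> D = `I_n.
Proof.
move=> Ddown DI.
have [allD|/existsNP[k Dk]] := pselect (forall k, D k).
  have DT : D = setT by apply/seteqP; split.
  by exfalso; apply: infinite_nat; rewrite -DT; exists n.
have exk : exists k, ~~ `[< D k >] by exists k; apply/asboolPn.
case: (ex_minnP exk) => m /asboolPn Dm mmin.
have Dm' : D = `I_m.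
  apply/seteqP; split=> i /= => [Di|im].
    by rewrite ltnNge; apply/negP => mi; exact: Dm (Ddown _ _ mi Di).
  by apply/asboolP; apply: contraTT im => /mmin; rewrite -leqNgt.
by rewrite Dm'; move: DI; rewrite Dm' => /card_eq_II ->.
Qed.

Lemma finite_nat_bounded (A : set nat) : finite_set A ->
  exists N, forall i, A i -> (i < N)%N.
Proof.
move=> /finite_seqP[s ->]; exists (\max_(i <- s) i).+1 => i /= si.
by rewrite ltnS; apply: (@leq_bigmax_seq _ s xpredT id i).
Qed.

End Decomposition.

(** * The decomposed form and the choice of the order *)

Section Main.
Context {R : realType} {nu ny : nat}.
Local Notation C := R[i].
Implicit Types (S : lin_system R nu ny) (J : jordan_data (R := R) nu ny).

Lemma jordan_input_bound S J : wf_system S -> jordan_coordinates S J ->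
  exists2 M : R, 0 <= M & forall n N u,
    \sum_(0 <= i < N) cmod ((jb J (n + i)%N *m u) 0 0) ^+ 2 <= M * vsq u.
Proof.
move=> [_ [uell _ [M BM]] _] [_ [_ [Phi [[_ Phiell] [k [K [_ kK]]] _ _ [_ PhiB _]]]]].
exists (`|K| * `|M|) => [|n N u]; first by rewrite mulr_ge0.
have hx : ell2 (Phi (opB S u)) by apply: Phiell; exact: uell.
have hs := (ell2_shift (Phi (opB S u)) n).2 hx.
have le1 : \sum_(0 <= i < N) cmod ((jb J (n + i)%N *m u) 0 0) ^+ 2 <=
    l2sq (Phi (opB S u)).
  have [_ ->] := l2sq_shift hs.
  have := sqmod_sum_le N hs; rewrite {1 3}PhiB => /le_trans; apply.
  by rewrite lerDr; apply: sumr_ge0 => i _; exact: sqr_ge0.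
have u0 := l2sq_ge0 (uell u).
apply: le_trans le1 (le_trans (kK _ (uell u)).2 _).
apply: (@le_trans _ _ (`|K| * l2sq (opB S u))).
  by rewrite ler_wpM2r// ler_norm.
rewrite -mulrA ler_wpM2l//; apply: le_trans (BM u) _.
by rewrite ler_wpM2r ?vsq_ge0// ler_norm.
Qed.

(** Testing the bounded output operator on the truncated conjugate of its own
    coefficients forces these to be square summable. *)
Lemma jordan_output_bound S J : wf_system S -> jordan_coordinates S J ->
  exists M : R, forall N, \sum_(0 <= i < N) vsq (jc J i) <= M.
Proof.
move=> [_ _ [_ [M CM]]] [_ [_ [Phi [_ [k [K [k0 kK]]] Phisurj _ [_ _ PhiC]]]]].
exists (\sum_(j < ny) `|M| / k) => N; rewrite /vsq exchange_big /=.
apply: ler_sum => j _; set A := \sum_(0 <= i < N) _.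
have A0 : 0 <= A by apply: sumr_ge0 => i _; exact: sqr_ge0.
pose y i : C := if (i < N)%N then Num.conj (jc J i j 0) else 0.
have y0 i : (N <= i)%N -> y i = 0 by rewrite /y ltnNge => ->.
have [ys0 ys0le] : ell2 (fun i => y (N + i)%N) /\ l2sq (fun i => y (N + i)%N) <= 0.
  have H n : \sum_(0 <= i < n) cmod (y (N + i)%N) ^+ 2 <= 0.
    rewrite big1// => i _.
    by rewrite y0 ?leq_addr// ComplexField.Normc.normc0 expr0n.
  by split; [exact: ell2_bounded H|exact: l2sq_le].
have [hy yE] := l2sq_shift ys0.
have yA : l2sq y <= A.
  rewrite yE (_ : A = \sum_(0 <= i < N) cmod (y i) ^+ 2) ?gerDl//.
  apply: eq_big_nat => i /andP[_ iN].
  by rewrite /y iN !cmod2E /cdot cRe_conj cIm_conj mulrNN.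
have [x hx Phix] := Phisurj y hy.
have cA : A ^+ 2 <= vsq (opC S x).
  rewrite (PhiC _ hx) Phix /vsq (bigD1 j)//= mxE.
  rewrite -[leLHS]addr0 lerD//; last first.
    by apply: sumr_ge0 => l _; exact: sqr_ge0.
  have -> : csum (fun i => (y i *: jc J i) j 0) =
            \sum_(0 <= i < N) (y i *: jc J i) j 0.
    by apply/csum_cvg_lim/csum_cvg_finite => i Ni; rewrite y0// scale0r mxE.
  rewrite cmod2E /cdot cRe_sum (_ : \sum_(0 <= i < N) cRe _ = A).
    by rewrite -expr2 lerDl -expr2 sqr_ge0.
  apply: eq_big_nat => i /andP[_ iN].
  by rewrite mxE /y iN cReM cRe_conj cIm_conj cmod2E /cdot; ring.
have xA : l2sq x <= A / k.
  by rewrite ler_pdivlMr// mulrC (le_trans (kK _ hx).1)// Phix.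
have : A ^+ 2 <= `|M| / k * A.
  apply: le_trans cA (le_trans (CM _ hx) _).
  apply: (@le_trans _ _ (`|M| * l2sq x)); first by rewrite ler_wpM2r ?l2sq_ge0// ler_norm.
  by rewrite -mulrA [_^-1 * _]mulrC ler_wpM2l.
have [->|An0] := eqVneq A 0; first by rewrite divr_ge0 ?(ltW k0).
by rewrite expr2 ler_pM2r// lt0r An0.
Qed.

(** The change of variable only cuts the Jordan coordinates of S at n0 and n.
    Blocks decouple because no Jordan chain crosses a cut, and the operator is
    diagonal after n. Square summability of the output coefficients is what
    makes it possible to split the series defining the output. *)
Lemma decomposed_form_decompose S J (d : R) n0 n :
  wf_system S -> jordan_coordinates S J -> (n0 <= n)%N ->
  (forall i, (- d <= cRe (jlam J i)) = (i < n0)%N) ->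
  (forall i, (n <= i)%N -> jeps J i = false) ->
  (forall i, i.+1 = n -> jeps J i = false) ->
  (forall i, i.+1 = n0 -> jeps J i = false) ->
  (forall i j, (i < n)%N -> (n <= j)%N -> cRe (jlam J j) < cRe (jlam J i)) ->
  decomposed_form S d (decompose J n0 n).
Proof.
move=> Swf JS n0n lamE eps_tail eps_n eps_n0 gap.
have [cB CM] := jordan_output_bound Swf JS.
have [Jdec [Jeps [Phi [[Phil Phiell] [k [K [k0 kK]]] Phisurj Phidom
  [PhiA PhiB PhiC]]]]] := JS.
pose m := (n - n0)%N.
have n0m : (n0 + m)%N = n by rewrite subnKC.
have nE i : (n + i = n0 + (m + i))%N by rewrite addnA n0m.
have AJ0 := @jordan_coef_mx _ nu ny J 0 n0 Jeps.
have AJ1 := @jordan_coef_mx _ nu ny J n0 m Jeps.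
split.
  split => //=.
  - move=> a /(jordan_eigenvalue AJ0)[i ->].
    by rewrite mxE /jordan_coef eqxx lamE ltn_ord.
  - move=> a /(jordan_eigenvalue AJ1)[i ->].
    by rewrite mxE /jordan_coef eqxx ltNge lamE -leqNgt leq_addr.
  - move=> i; split.
      by rewrite ltNge lamE -leqNgt (leq_trans n0n)// leq_addr.
    move=> a /(jordan_eigenvalue AJ1)[j ->].
    rewrite mxE /jordan_coef eqxx gap ?leq_addr//.
    by rewrite -[X in (_ < X)%N]n0m ltn_add2l.
exists (fun x => \col_(i < n0) Phi x i),
       (fun x => \col_(i < m) Phi x (n0 + i)%N),
       (fun x i => Phi x (n + i)%N).
have splitE y : ell2 y -> l2sq y = vsq (\col_(i < n0) y i) +
    vsq (\col_(i < m) y (n0 + i)%N) + l2sq (fun i => y (n + i)%N).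
  move=> hy; have [_ ->] := l2sq_shift ((ell2_shift y n).2 hy).
  congr (_ + _); rewrite (sum_nat_split _ n0n).
  by congr (_ + _); apply: eq_bigr => i _; rewrite mxE.
have tailE y : (fun i => jlam J (n + i) * y (n + i)%N) =
    (fun i => jordan_apply J y (n + i)%N).
  by apply/funext => i; rewrite /jordan_apply eps_tail ?leq_addr// mul0r addr0.
split.
- split.
  + by move=> a x y hx hy; apply/colP => i; rewrite !mxE Phil.
  + by move=> a x y hx hy; apply/colP => i; rewrite !mxE Phil.
  + by move=> a x y hx hy; apply/funext => i; rewrite Phil.
  + by move=> x hx; apply/ell2_shift; exact: Phiell.
- exists k, K; split => // x hx /=.
  by rewrite -splitE; [exact: kK|exact: Phiell].
- move=> v0 v1 w hw.
  pose y := cat_vec v0 (cat_vec (v1 : 'cV_m) w).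
  have yw : (fun i => y (n + i)%N) = w.
    by apply/funext => i; rewrite nE /y !cat_vec_ge.
  have hy : ell2 y by apply/(ell2_shift y n); rewrite yw.
  have [x hx Phix] := Phisurj y hy; exists x => //; rewrite Phix; split => //.
    by apply/colP => i; rewrite mxE /y cat_vec_lt.
  by apply/colP => i; rewrite mxE /y cat_vec_ge cat_vec_lt.
- move=> x /=; rewrite tailE; split=> [/Phidom[hx]|[hx]] hJ.
    by split=> //; apply/(ell2_shift (jordan_apply J (Phi x))).
  by apply/Phidom; split=> //; apply/(ell2_shift (jordan_apply J (Phi x)) n).
- split=> [x hx|u|x hx].
  + rewrite PhiA// tailE; split=> //; apply/colP => i; rewrite !mxE.
      rewrite -[i : nat]add0n -jordan_coef_apply//.
      by apply: eq_bigr => j _; rewrite !mxE.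
    rewrite -jordan_coef_apply ?n0m//.
    by apply: eq_bigr => j _; rewrite !mxE.
  + rewrite PhiB; split=> //; apply/colP => i; rewrite !mxE;
      by apply: eq_bigr => j _; rewrite !mxE.
  + rewrite PhiC//; apply/colP => j; rewrite !mxE.
    have hP := Phiell _ hx; have hc := ell2_entry (j:=j) CM.
    have -> : (fun i => (Phi x i *: jc J i) j 0) = (fun i => Phi x i * jc J i j 0).
      by apply/funext => i; rewrite mxE.
    rewrite (csum_mul_split n hP hc); congr (_ + _); last first.
      by congr csum; apply/funext => i; rewrite mxE.
    rewrite (sum_nat_split _ n0n).
    by congr (_ + _); apply: eq_bigr => i _; rewrite !mxE mulrC.
Qed.

(** Take the first index at which u is below both a and u N. *)
Lemma exists_strict_drop (u : nat -> R) N a :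
  (forall i j, (i <= j)%N -> u j <= u i) -> u @ \oo --> -oo ->
  exists n, [/\ (N < n)%N, u n <= a & forall i, (i < n)%N -> u n < u i].
Proof.
move=> udec /cvgrNyPlt/(_ (Num.min a (u N)))[k _ /(_ k (leqnn k)) uk].
have exn : exists n, u n < Num.min a (u N) by exists k.
case: (ex_minnP exn) => n un nmin; exists n; split=> [||i i_n].
- rewrite ltnNge; apply/negP => /udec; rewrite leNgt => /negP; apply.
  by move: un; rewrite lt_min => /andP[].
- by move: un; rewrite lt_min => /andP[/ltW].
- by apply: lt_le_trans un _; rewrite leNgt; apply: contraTN i_n => /nmin;
    rewrite -leqNgt.
Qed.

End Main.

Theorem corollary1 (R : realType) (nu ny : nat) (delta : R) (hdelta : 0 < delta)
    (S : lin_system R nu ny) (v : nat -> nat -> R[i]) (mu : nat -> R[i])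
    (hS : wf_system S) (hv : gen_eigen_riesz S v mu)
    (h1 : assumption1 S mu) (h2 : assumption2 S)
    (J : jordan_data nu ny) (hJ : jordan_coordinates S J)
    (hlam : (fun i => cRe (jlam J i)) @ \oo --> -oo)
    (n0 n1 : nat)
    (hn0 : ([set i | - delta <= cRe (jlam J i)] #= `I_n0)%card)
    (hn1 : ([set i | cRe (jlam J i) < - delta /\
              exists2 j, j <> i & jlam J j = jlam J i] #= `I_n1)%card)
    (K0 : 'M[R[i]]_(nu, n0)) (G0 : 'M[R[i]]_(n0, ny)) (P0 : 'M[R[i]]_(n0 + n0))
    (hP0 : posdefmx P0)
    (hLMI : let F0 := F0_mx (lead_A J n0) (lead_B J n0) (lead_C J n0) K0 G0 in
       posdefmx (- (2 * delta)%:C *: P0 - (P0 *m F0 + ctrmx F0 *m P0))) :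
  exists n : nat,
    [/\ (n0 + n1 <= n)%N,
        decomposed_form S delta (decompose J n0 n) &
        exp_stable (decompose J n0 n) K0 G0 delta].
Proof.
have [MB MB0 hB] := jordan_input_bound hS hJ.
have [Cc hC] := jordan_output_bound hS hJ.
have [al hal] := stable_of_fast_tail Cc hdelta hP0 hLMI MB0.
have [Jdec [Jeps _]] := hJ.
have lamE i : (- delta <= cRe (jlam J i)) = (i < n0)%N.
  have := downset_card _ hn0 => /(_ _)/seteqP [|D1 D2].
    by move=> a b ab /= /le_trans; apply; exact: Jdec.
  by apply/idP/idP => [/D1//|/D2].
have [N1 N1P] := finite_nat_bounded (ex_intro _ n1 hn1 : finite_set _).
pose N := maxn (n0 + n1) N1.
(* Past N every eigenvalue is simple: a Jordan chain would give one of the n1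
   multiple eigenvalues. *)
have epsN i : (N <= i)%N -> jeps J i = false.
  move=> Ni; apply/negP => /Jeps e.
  have n0i : (n0 <= i)%N.
    by rewrite (leq_trans _ Ni)// leq_max (leq_trans (leq_addr n1 n0)).
  have /N1P : cRe (jlam J i) < - delta /\ exists2 j, j <> i & jlam J j = jlam J i.
    split; first by rewrite ltNge lamE -leqNgt.
    by exists i.+1 => // /eqP; rewrite gtn_eqF.
  by rewrite ltnNge (leq_trans _ Ni)// leq_maxr.
have [n [Nn nal ngap]] := exists_strict_drop N (- al) Jdec hlam.
have n0n : (n0 + n1 <= n)%N by rewrite (leq_trans _ (ltnW Nn))// leq_maxl.
have n0n' : (n0 <= n)%N := leq_trans (leq_addr _ _) n0n.
exists n; split => //.
  apply: decomposed_form_decompose => //.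
  - by move=> i ni; apply: epsN; apply: leq_trans ni; exact: ltnW.
  - by move=> i iE; apply: epsN; rewrite -ltnS iE.
  - move=> i iE; apply/negP => /Jeps e.
    by have := lamE i; rewrite -e lamE iE ltnn leqnn.
  - by move=> i j /ngap ni nj; apply: le_lt_trans ni; exact: Jdec.
apply: hal => //=.
- exact: jordan_coef_mx.
- move=> i; rewrite mxE /jordan_coef eqxx ltW// ltNge lamE -leqNgt leq_addr//.
- by move=> i; apply: le_trans nal; apply: Jdec; rewrite leq_addr.
- move=> M; apply: le_trans (hC (n + M)%N).
  rewrite (sum_nat_split _ (leq_addr M n)) addKn big_mkord lerDr.
  by apply: sumr_ge0 => i _; exact: vsq_ge0.
Qed.
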